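(* Let $\phi : M^2 \rightarrow \mathbb{R}^{4}$ be a closed homothetic soliton for the inverse mean curvature flow. If $\phi$ is Lagrangian then $M^2$ is, up to dilations, the Clifford torus $\mathbb{S}^1 \times \mathbb{S}^1$.
   Context: Let $\phi : M^n \to \mathbb{R}^m$ be an isometric immersion of an $n$-dimensional manifold in Euclidean $m$-space, with second fundamental form $\sigma$ and nonvanishing mean curvature vector $H=\mathrm{trace}\,\sigma$ (not divided by $n$). $\phi$ is called a homothetic soliton for the inverse mean curvature flow if there is a real constant $a\neq 0$ with $-\frac{H}{|H|^2}=a\,\phi^\bot$, where $\phi^\bot$ is the projection of the position vector $\phi$ onto the normal bundle of $M$. This condition is invariant under dilations $\phi\mapsto\rho\phi$, $\rho>0$. Closed means compact without boundary. An immersion $\phi:M^n\to\mathbb{R}^{2n}\equiv\mathbb{C}^n$ is Lagrangian if $\phi^*\omega=0$, where $\omega(\cdot,\cdot)=\langle J\cdot,\cdot\rangle$ is the Kaehler two-form and $J$ is the complex structure of $\mathbb{C}^n$. The Clifford torus is the product $\mathbb{S}^1\times\mathbb{S}^1\subset\mathbb{C}\times\mathbb{C}=\mathbb{C}^2\equiv\mathbb{R}^4$ of two unit circles centered at the origin. *)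

(* Defs.v *)
From HB Require Import structures.
From mathcomp Require Import all_boot all_order all_algebra.
From mathcomp Require Import all_classical all_reals all_analysis.

Set Implicit Arguments.
Unset Strict Implicit.
Unset Printing Implicit Defensive.

Import Order.TTheory GRing.Theory Num.Theory numFieldNormedType.Exports.

Local Open Scope classical_set_scope.
Local Open Scope ring_scope.

Section Smooth.
Context {R : realType}.

Fixpoint Ck_on (k n m : nat) (U : set 'rV[R]_n) (f : 'rV[R]_n -> 'rV[R]_m)
    : Prop :=
  if k is k'.+1 then
    (forall u, U u -> differentiable f u) /\
    (forall v : 'rV[R]_n, Ck_on k' U ('D_v f))
  else forall u, U u -> {for u, continuous f}.

(* Meant for U open, as the derivatives are taken in the whole of R^n. *)
Definition smooth_on n m (U : set 'rV[R]_n) (f : 'rV[R]_n -> 'rV[R]_m) : Prop :=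
  forall k, Ck_on k U f.

End Smooth.

(* An atlas, presented by its local parametrizations [par i], defined on the
   open sets [dom i] of R^n; [crd i], the chart itself, inverts [par i] on its
   image.  The values of [par i] and [crd i] elsewhere are irrelevant. *)
Record smooth_atlas (R : realType) (n : nat) (M : topologicalType) := SmoothAtlas {
  idx : Type;
  dom : idx -> set 'rV[R]_n;
  par : idx -> 'rV[R]_n -> M;
  crd : idx -> M -> 'rV[R]_n;
  open_dom : forall i, open (dom i);
  open_img : forall i, open (par i @` dom i);
  parK : forall i u, dom i u -> crd i (par i u) = u;
  par_continuous : forall i u, dom i u -> {for u, continuous (par i)};
  crd_continuous : forall i p, (par i @` dom i) p -> {for p, continuous (crd i)};
  atlas_cover : forall p, exists i, (par i @` dom i) p;
  transition_smooth : forall i j,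
    smooth_on (dom i `&` par i @^-1` (par j @` dom j)) (crd j \o par i) }.

Arguments dom {R n M} s _ _.
Arguments par {R n M} s _ _.
Arguments crd {R n M} s _ _.

(* Second countability is automatic for compact locally Euclidean spaces. *)
Definition closed_connected_manifold (M : topologicalType) : Prop :=
  [/\ hausdorff_space M, compact [set: M], connected [set: M] & [set: M] !=set0].

Section LocalGeometry.
Context {R : realType} {n m : nat}.
Implicit Types (f : 'rV[R]_n -> 'rV[R]_m) (u : 'rV[R]_n).

(* Euclidean inner product; the library's [`|v|] on row vectors is the sup
   norm and is not used for |H|. *)
Definition dotp {d} (v w : 'rV[R]_d) : R := (v *m w^T) 0 0.

(* Coefficients g_ij of the induced metric; the rows of the Jacobian matrix are
   the coordinate tangent vectors d_i f. *)
Definition metric f u : 'M[R]_n := jacobian f u *m (jacobian f u)^T.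

(* v^T = sum_ij g^ij <v, d_i f> d_j f, and v^bot = v - v^T. *)
Definition normal_part f u (v : 'rV[R]_m) : 'rV[R]_m :=
  v - v *m (jacobian f u)^T *m invmx (metric f u) *m jacobian f u.

(* sigma (d_i, d_j) = (d_i d_j f)^bot *)
Definition second_ff f u (i j : 'I_n) : 'rV[R]_m :=
  normal_part f u
    ('D_(delta_mx 0 i : 'rV[R]_n) ('D_(delta_mx 0 j : 'rV[R]_n) f) u).

(* Trace with respect to the induced metric, not divided by n. *)
Definition mean_curvature f u : 'rV[R]_m :=
  \sum_(i < n) \sum_(j < n) invmx (metric f u) i j *: second_ff f u i j.

End LocalGeometry.

Section Immersions.
Context {R : realType} {n m : nat} {M : topologicalType}.
Variables (A : smooth_atlas R n M) (phi : M -> 'rV[R]_m).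

(* M carries the metric induced by phi, so that phi is isometric. *)
Definition immersion : Prop := forall i,
  smooth_on (dom A i) (phi \o par A i) /\
  (forall u, dom A i u -> injective ('d (phi \o par A i) u)).

Definition homothetic_soliton : Prop :=
  (forall i u, dom A i u -> mean_curvature (phi \o par A i) u != 0) /\
  exists2 a : R, a != 0 & forall i u, dom A i u ->
    let H := mean_curvature (phi \o par A i) u in
    - ((dotp H H)^-1 *: H) = a *: normal_part (phi \o par A i) u (phi (par A i u)).

End Immersions.

Section ComplexSpace.
Context {R : realType} {n : nat}.

(* C^n is R^(n + n), with z_k = x_k + i y_k stored as
   x_k = z 0 (lshift n k) and y_k = z 0 (rshift n k). *)
Definition cplxJ (z : 'rV[R]_(n + n)) : 'rV[R]_(n + n) :=
  row_mx (- rsubmx z) (lsubmx z).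

Definition kaehler_form (v w : 'rV[R]_(n + n)) : R := dotp (cplxJ v) w.

Definition lagrangian (M : topologicalType) (A : smooth_atlas R n M)
    (phi : M -> 'rV[R]_(n + n)) : Prop :=
  forall i u, dom A i u -> forall X Y : 'rV[R]_n,
    kaehler_form ('d (phi \o par A i) u X) ('d (phi \o par A i) u Y) = 0.

Definition unitary (U : 'M[R]_(n + n)) : Prop :=
  U *m U^T = 1%:M /\ forall z, cplxJ (z *m U) = cplxJ z *m U.

End ComplexSpace.

Definition clifford_torus (R : realType) : set 'rV[R]_(2 + 2) :=
  [set z | forall k : 'I_2,
     z 0 (lshift 2 k) ^+ 2 + z 0 (rshift 2 k) ^+ 2 = 1].
Arguments clifford_torus R : clear implicits.

(* Main.v *)
Require Import Defs.
From HB Require Import structures.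
From mathcomp Require Import all_boot all_order all_algebra.
From mathcomp Require Import all_classical all_reals all_analysis.
From mathcomp Require Import perm ring lra.
Set Implicit Arguments.
Unset Strict Implicit.
Unset Printing Implicit Defensive.
Import Order.TTheory GRing.Theory Num.Theory numFieldNormedType.Exports.
Local Open Scope classical_set_scope.
Local Open Scope ring_scope.

(* Pairing the soliton equation with H gives <H, phi> = -1/a, so the Laplacian
   of |phi|^2 / 2 is the constant 2 - 1/a; at a minimum it is nonnegative, so
   the strong maximum principle makes |phi| constant, and then H is a multiple
   of phi, i.e. phi is minimal in a sphere of radius r.

   For a Lagrangian surface f in that sphere, J f is tangent.  Let w be tangent
   and orthogonal to J f.  The cubic form C(X, Y, Z) = <sigma(X, Y), J Z> is
   symmetric, C(X, Y, J f) = <X, Y>, and minimality gives C(w, w, w) = 0, so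
   the second fundamental form is explicit.  Identify C^2 with the quaternions,
   J being left multiplication by i.  Then w is, up to a real factor, f
   multiplied on the right by an imaginary quaternion m(f),
   and differentiating shows that the line R m(f) is locally constant.  As
   <J f, w> = 0, the image locally satisfies <J z, z mu> = 0 for a fixed
   imaginary mu, and then everywhere since M is connected.  In unitary
   coordinates this form is k (|z_1|^2 - |z_2|^2), so the image lies in a
   Clifford torus.  Conversely, for z in that torus a maximum point p of
   <z, phi> satisfies z = phi(p) by the first and second order conditions. *)

(** * Derivatives along lines *)

(** The Laplacian of |phi|^2 / 2 is one constant on the whole surface, so the sign found at a
    minimum point makes the function subharmonic everywhere. Once |phi| is constant, phi is normal,
    phi^bot is phi itself, and the soliton equation makes H parallel to phi.

    The equality C(w, w, w) = 0 is read off the trace in the orthogonal frame J f, w, whose other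
    diagonal term is C(J f, J f, w) = <J f, w> = 0. Charts are arbitrary and no orthonormal frame is
    chosen, so these facts become polynomial identities in the metric coefficients. For the same
    reason w is not normalised: m(f) varies by a real factor, and only its line can be constant,
    which is expressed through the orthogonal projection onto that line.

    An immersion of a closed surface in a torus is open, hence onto; the argument with the maximum
    of <z, phi> takes the place of this and uses only first and second derivatives. *)

Section DirectionalDerivatives.
Context {R : realType} {V : normedModType R}.
Implicit Types (F : V -> R) (a u v w x : V).

Lemma is_derive_line {W : normedModType R} (F : V -> W) a v (t : R) df :
  is_derive (t *: v + a) v F df -> is_derive t 1 (fun s => F (s *: v + a)) df.
Proof.
have E : (fun h : R => h^-1 *: (F ((h *: 1 + t) *: v + a) - F (t *: v + a))) =
         (fun h => h^-1 *: (F (h *: v + (t *: v + a)) - F (t *: v + a))).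
  by apply/funext => h; rewrite scalerDl addrA [h *: 1]mulr1.
by case=> dF <-; split; rewrite /derivable /derive /= E.
Qed.

Lemma is_derive_translate {W : normedModType R} (F : V -> W) a v x df :
  is_derive (a + x) v F df -> is_derive x v (fun y => F (a + y)) df.
Proof.
have E : (fun h : R => h^-1 *: (F (a + (h *: v + x)) - F (a + x))) =
         (fun h => h^-1 *: (F (h *: v + (a + x)) - F (a + x))).
  by apply/funext => h; rewrite addrCA.
by case=> dF <-; split; rewrite /derivable /derive /= E.
Qed.

Lemma MVT_line F a v (h : R) : 0 < h ->
  (forall t, 0 <= t <= h -> derivable F (t *: v + a) v) ->
  exists2 t, 0 < t < h & F (h *: v + a) - F a = h * 'D_v F (t *: v + a).
Proof.
move=> h0 dF; pose g t := F (t *: v + a).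
have dg t : 0 <= t <= h -> is_derive t 1 g ('D_v F (t *: v + a)).
  by move=> /dF ?; apply/is_derive_line/derivableP.
have [||t] := @MVT R g (fun t => 'D_v F (t *: v + a)) 0 h h0.
- by move=> t; rewrite in_itv /= => /andP[? ?]; apply: dg; rewrite !ltW.
- apply: derivable_within_continuous => t; rewrite in_itv /= => /dg.
  by case.
- rewrite in_itv /= => th; rewrite /g scale0r add0r subr0 => E.
  by exists t => //; rewrite E mulrC.
Qed.

Lemma near_segment a v w (P : set V) : (\forall x \near a, P x) ->
  exists2 h : R, 0 < h &
    forall s t, 0 <= s <= h -> 0 <= t <= h -> P (s *: w + (t *: v + a)).
Proof.
move=> /nbhs_normP[e /= e0 eP].
have K0 : 0 < `|v| + `|w| + 1 by rewrite ltr_wpDl// addr_ge0.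
exists (e / (`|v| + `|w| + 1)); first by rewrite divr_gt0.
move=> s t /andP[s0 sh] /andP[t0 th]; apply: eP => /=.
rewrite /ball_ /= distrC addrA addrK (le_lt_trans (ler_normD _ _))// !normrZ !ger0_norm//.
have h0 : 0 < e / (`|v| + `|w| + 1) by rewrite divr_gt0.
apply: (@le_lt_trans _ _ (e / (`|v| + `|w| + 1) * (`|v| + `|w|))).
  by rewrite mulrDr addrC lerD// ler_wpM2r.
rewrite -[ltRHS](@divfK _ (`|v| + `|w| + 1)) ?gt_eqF//.
by rewrite ltr_pM2l// ltrDl.
Qed.

(** The mean value theorem is applied twice, to the increment [G] of F and then to ['D_v F]. The
    left-hand side is unchanged when v and w are swapped, which is what [derive_comm] exploits. *)
Lemma second_difference F a v w (h : R) : 0 < h ->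
  (forall s t, 0 <= s <= h -> 0 <= t <= h ->
     derivable F (s *: w + (t *: v + a)) v /\
     derivable ('D_v F) (s *: w + (t *: v + a)) w) ->
  exists s t, [/\ 0 < s < h, 0 < t < h &
    F (h *: w + (h *: v + a)) - F (h *: w + a) - (F (h *: v + a) - F a) =
    h * (h * 'D_w ('D_v F) (s *: w + (t *: v + a)))].
Proof.
move=> h0 dF; pose G x := F (h *: w + x) - F x.
have hh : 0 <= h <= h by rewrite lexx ltW.
have zh : (0 : R) <= 0 <= h by rewrite lexx ltW.
have dG t : 0 <= t <= h -> is_derive (t *: v + a) v G
    ('D_v F (h *: w + (t *: v + a)) - 'D_v F (t *: v + a)).
  move=> th; apply: is_deriveB.
    by apply/is_derive_translate/derivableP; have [] := dF h t hh th.
  by apply/derivableP; have [] := dF 0 t zh th; rewrite scale0r add0r.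
have [|t th E1] := @MVT_line G a v h h0; first by move=> t /dG[].
have th' : 0 <= t <= h by case/andP: th => ? ?; rewrite !ltW.
have [|s sh E2] := @MVT_line ('D_v F) (t *: v + a) w h h0.
  by move=> s sh; have [] := dF s t sh th'.
exists s, t; split => //.
by rewrite -E2; have [_ <-] := dG t th'; rewrite -E1 /G; ring.
Qed.

(** Schwarz's theorem: both mixed derivatives compute one second difference, so they take a common
    value at two points of the same small parallelogram, and continuity at a does the rest. *)
Lemma derive_comm F a v w :
  (\forall x \near a, [/\ derivable F x v, derivable F x w,
     derivable ('D_v F) x w & derivable ('D_w F) x v]) ->
  {for a, continuous ('D_w ('D_v F))} -> {for a, continuous ('D_v ('D_w F))} ->
  'D_w ('D_v F) a = 'D_v ('D_w F) a.
Proof.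
move=> dF c1 c2; apply/eqP; rewrite -subr_eq0; apply/negPn/negP => ne.
pose e := `|'D_w ('D_v F) a - 'D_v ('D_w F) a| / 2.
have e0 : 0 < e by rewrite divr_gt0// normr_gt0.
have n1 : \forall x \near a, `|'D_w ('D_v F) a - 'D_w ('D_v F) x| < e.
  by move/cvgrPdist_lt : c1; apply.
have n2 : \forall x \near a, `|'D_v ('D_w F) a - 'D_v ('D_w F) x| < e.
  by move/cvgrPdist_lt : c2; apply.
have [h h0 Ph] := @near_segment a v w _ (filterI dF (filterI n1 n2)).
have Pf s t : 0 < s < h -> 0 < t < h ->
    `|'D_w ('D_v F) a - 'D_w ('D_v F) (s *: w + (t *: v + a))| < e /\
    `|'D_v ('D_w F) a - 'D_v ('D_w F) (s *: w + (t *: v + a))| < e.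
  by move=> /andP[? ?] /andP[? ?]; have [] := Ph s t; rewrite ?ltW// => _ [].
have [|s [t [sh th E1]]] := @second_difference F a v w h h0.
  by move=> s t sh th; have [[]] := Ph s t sh th.
have [|t' [s' [th' sh' E2]]] := @second_difference F a w v h h0.
  by move=> s' t' sh' th'; rewrite addrCA; have [[]] := Ph t' s' th' sh'.
move: E2; rewrite (addrCA (h *: v)) (addrCA (t' *: v)) => E2.
have /(mulfI (lt0r_neq0 h0))/(mulfI (lt0r_neq0 h0)) E :
    h * (h * 'D_w ('D_v F) (s *: w + (t *: v + a))) =
    h * (h * 'D_v ('D_w F) (s' *: w + (t' *: v + a))).
  by rewrite -E1 -E2; ring.
have [A1 _] := Pf _ _ sh th.
have [_ A2] := Pf _ _ sh' th'.
have : `|'D_w ('D_v F) a - 'D_v ('D_w F) a| < e + e.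
  apply: le_lt_trans (ltrD A1 A2).
  rewrite E [X in _ <= _ + X]distrC.
  apply: le_trans (ler_normD _ _).
  by rewrite addrA subrK.
by rewrite /e -splitr ltxx.
Qed.

Lemma derive_local_max F a v :
  (\forall x \near a, derivable F x v) -> derivable ('D_v F) a v ->
  (\forall x \near a, F x <= F a) -> 'D_v F a = 0 /\ 'D_v ('D_v F) a <= 0.
Proof.
move=> dF ddF mF.
have [h h0 Ph] := @near_segment a v (- v) _ (filterI dF mF).
have P1 t : 0 <= t <= h -> derivable F (t *: v + a) v /\ F (t *: v + a) <= F a.
  move=> th; have := Ph 0 t; rewrite scale0r add0r lexx ltW// => /(_ isT th).
  by [].
have P2 t : 0 <= t <= h -> derivable F (- t *: v + a) v /\ F (- t *: v + a) <= F a.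
  move=> th; have := Ph t 0 th; rewrite lexx ltW// => /(_ isT).
  by rewrite scale0r add0r scalerN -scaleNr.
have D0 : 'D_v F a = 0.
  pose g t := F (t *: v + a).
  have P t : t \in `]-h, h[ -> derivable F (t *: v + a) v /\ F (t *: v + a) <= F a.
    rewrite in_itv /= => /andP[h1 h2]; have [t0|t0] := leP 0 t.
      by apply: P1; rewrite t0 ltW.
    by have := P2 (- t); rewrite opprK; apply; rewrite oppr_ge0 !ltW// ltrNl.
  have I0 : (0 : R) \in `]-h, h[ by rewrite in_itv /= oppr_lt0 h0.
  have := @derive1_at_max R g (-h) h 0 _ _ I0.
  case=> [||t tI|_ Dg].
  - by rewrite ge0_cp // ltW.
  - move=> t tI; have [/derivableP/is_derive_line[]] := P t tI; by [].
  - by rewrite /g scale0r add0r; have [] := P t tI.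
  - have [/derivableP/is_derive_line[_ E]] := P 0 I0.
    by move: E; rewrite -/g Dg scale0r add0r.
(* A positive second derivative would make ['D_v F] positive just after a on the line, hence F
   larger there than at a. *)
split=> //; rewrite leNgt; apply/negP => d0.
have := ddF => /cvgrPdist_lt /(_ _ d0).
rewrite -[lim _]/('D_v ('D_v F) a) /dnbhs => /nbhs_normP [e /= e0 Pe].
pose k := Num.min (e / 2) h.
have k0 : 0 < k by rewrite lt_min h0 divr_gt0.
have kh : k <= h by rewrite ge_min lexx orbT.
have ke : k < e by rewrite gt_min ltr_pdivrMr// ltr_pMr// ltr1n.
have [|t /andP[t0 tk] E] := @MVT_line F a v k k0.
  by move=> t /andP[t0 tk]; have [] := P1 t; rewrite ?t0 ?(le_trans tk).
have := Pe t; rewrite /ball_ /= sub0r normrN gtr0_norm// (lt_trans tk ke) => /(_ isT).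
rewrite gt_eqF// => /(_ isT); rewrite D0 subr0 => Hd.
have Dt : 0 < 'D_v F (t *: v + a).
  rewrite -(pmulr_rgt0 _ (_ : 0 < t^-1)) ?invr_gt0//.
  have := ler_norm ('D_v ('D_v F) a - t^-1 * 'D_v F (t *: v + a)).
  by move=> /le_lt_trans/(_ Hd); rewrite ltrBlDr ltrDl.
have [|_] := P1 k; first by rewrite kh ltW.
by rewrite -subr_le0 E leNgt mulr_gt0.
Qed.

End DirectionalDerivatives.

(** * Calculus of matrix-valued maps and the Euclidean inner product *)

Section MatrixCalculus.
Context {R : realType}.

Lemma cvg_mxP {T : Type} {F : set_system T} {FF : Filter F} m n
    (M : T -> 'M[R]_(m, n)) (L : 'M[R]_(m, n)) :
  M @ F --> L <-> forall i j, (fun x => M x i j) @ F --> L i j.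
Proof.
split=> [ML i j|ML].
  apply/cvgrPdist_le => e e0; move/cvgrPdist_le : ML => /(_ e e0).
  apply: filterS => x; apply: le_trans.
  rewrite [leRHS]/Num.Def.normr/= mx_normrE.
  by apply: le_trans; last exact: (le_bigmax _ _ (i, j)); rewrite !mxE.
apply/cvgrPdist_le => e e0; near=> x.
rewrite /Num.Def.normr/= mx_normrE (bigmax_le _ (ltW e0))//= => i _.
rewrite !mxE/=; move: i; near: x; apply: filter_forall => /= i.
by move/cvgrPdist_le : (ML i.1 i.2); apply.
Unshelve. all: by end_near. Qed.

Lemma continuous_mxP {T : topologicalType} m n (M : T -> 'M[R]_(m, n)) x :
  {for x, continuous M} <-> forall i j, {for x, continuous (fun y => M y i j)}.
Proof. exact: cvg_mxP. Qed.

Lemma continuous_ext {T U : topologicalType} (f g : T -> U) x :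
  f =1 g -> {for x, continuous f} -> {for x, continuous g}.
Proof. by move=> /funext ->. Qed.

Lemma continuous_sumr {T : topologicalType} (I : Type) (r : seq I)
    (f : I -> T -> R) x :
  (forall i, {for x, continuous (f i)}) ->
  {for x, continuous (fun y => \sum_(i <- r) f i y)}.
Proof.
move=> cf; elim: r => [|i r IH].
  by apply: (@continuous_ext _ _ (cst 0)) => [y|]; [rewrite big_nil|exact: cst_continuous].
apply: (@continuous_ext _ _ (f i + fun y => \sum_(j <- r) f j y)).
  by move=> y; rewrite big_cons.
exact: (@continuousD _ _ _ (f i) _ _ (cf i) IH).
Qed.

Lemma continuous_mulmx {T : topologicalType} m n p (A : T -> 'M[R]_(m, n))
    (B : T -> 'M[R]_(n, p)) x : {for x, continuous A} ->
  {for x, continuous B} -> {for x, continuous (fun y => A y *m B y)}.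
Proof.
move=> /continuous_mxP cA /continuous_mxP cB; apply/continuous_mxP => i k.
apply: (@continuous_ext _ _ (fun y => \sum_j A y i j * B y j k)).
  by move=> y; rewrite mxE.
by apply: continuous_sumr => j;
  apply: (@continuousM _ _ (fun y => A y i j) (fun y => B y j k)).
Qed.

Lemma continuous_trmx {T : topologicalType} m n (A : T -> 'M[R]_(m, n)) x :
  {for x, continuous A} -> {for x, continuous (fun y => (A y)^T)}.
Proof.
move=> /continuous_mxP cA; apply/continuous_mxP => i k.
by apply: (@continuous_ext _ _ (fun y => A y k i)) => [y|]; [rewrite mxE|exact: cA].
Qed.

Lemma continuous_dotp {T : topologicalType} n (v w : T -> 'rV[R]_n) x :
  {for x, continuous v} -> {for x, continuous w} ->
  {for x, continuous (fun y => dotp (v y) (w y))}.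
Proof.
move=> cv cw; have := continuous_mulmx cv (continuous_trmx cw).
by move/continuous_mxP; apply.
Qed.

Lemma continuous_mxtrace {T : topologicalType} n (A : T -> 'M[R]_n) x :
  {for x, continuous A} -> {for x, continuous (fun y => \tr (A y))}.
Proof.
by move=> /continuous_mxP cA; apply: continuous_sumr => i; exact: cA.
Qed.

Section Derive.
Context {V : normedModType R}.
Implicit Types x v : V.

Lemma is_derive_mxP m n (M : V -> 'M[R]_(m, n)) x v dM :
  is_derive x v M dM <-> forall i j, is_derive x v (fun y => M y i j) (dM i j).
Proof.
split=> [[/[dup] dMx /derivable_mxP dMxi <-] i j|dMx].
  by rewrite derive_mx// mxE; apply/derivableP.
have dMv : derivable M x v by apply/derivable_mxP => i j; case: (dMx i j).
split=> //; rewrite derive_mx//; apply/matrixP => i j; rewrite mxE.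
by case: (dMx i j).
Qed.

Lemma is_derive_fsum n (h : 'I_n -> V -> R) x v (dh : 'I_n -> R) :
  (forall i, is_derive x v (h i) (dh i)) ->
  is_derive x v (fun y => \sum_(i < n) h i y) (\sum_(i < n) dh i).
Proof.
by move=> /is_derive_sum; congr is_derive; apply/funext => y; rewrite fct_sumE.
Qed.

Lemma is_derive_fmul (f g : V -> R) x v df dg : is_derive x v f df ->
  is_derive x v g dg -> is_derive x v (fun y => f y * g y) (df * g x + f x * dg).
Proof.
by move=> f' g'; have := is_deriveM f' g'; congr is_derive; rewrite addrC [_ *: df]mulrC.
Qed.

Lemma is_derive_mulmx m n p (A : V -> 'M[R]_(m, n)) (B : V -> 'M[R]_(n, p))
    x v dA dB : is_derive x v A dA -> is_derive x v B dB ->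
  is_derive x v (fun y => A y *m B y) (dA *m B x + A x *m dB).
Proof.
move=> /is_derive_mxP A' /is_derive_mxP B'; apply/is_derive_mxP => i k.
under [fun y => _]eq_fun do rewrite mxE.
rewrite !mxE -big_split; apply: is_derive_fsum => j.
exact: is_derive_fmul.
Qed.

Lemma is_derive_trmx m n (A : V -> 'M[R]_(m, n)) x v dA :
  is_derive x v A dA -> is_derive x v (fun y => (A y)^T) dA^T.
Proof.
move=> /is_derive_mxP A'; apply/is_derive_mxP => i k.
by under [fun y => _]eq_fun do rewrite mxE; rewrite mxE.
Qed.

Lemma is_derive_dotp n (f g : V -> 'rV[R]_n) x v df dg :
  is_derive x v f df -> is_derive x v g dg ->
  is_derive x v (fun y => dotp (f y) (g y)) (dotp df (g x) + dotp (f x) dg).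
Proof.
move=> f' g'; have := is_derive_mulmx f' (is_derive_trmx g').
by move/is_derive_mxP/(_ 0 0); rewrite mxE.
Qed.

Lemma is_derive_mulmxr m n p (A : V -> 'M[R]_(m, n)) (B : 'M[R]_(n, p)) x v dA :
  is_derive x v A dA -> is_derive x v (fun y => A y *m B) (dA *m B).
Proof.
move=> A'; have := is_derive_mulmx A' (is_derive_cst B x v).
by rewrite mulmx0 addr0.
Qed.

Lemma is_derive_fscale m n (f : V -> R) (A : V -> 'M[R]_(m, n)) x v df dA :
  is_derive x v f df -> is_derive x v A dA ->
  is_derive x v (fun y => f y *: A y) (df *: A x + f x *: dA).
Proof.
move=> f' /is_derive_mxP A'; apply/is_derive_mxP => i k.
under [fun y => _]eq_fun do rewrite mxE.
by rewrite !mxE; exact: is_derive_fmul.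
Qed.

Lemma is_derive_unique {W : normedModType R} (f : V -> W) x v d1 d2 :
  is_derive x v f d1 -> is_derive x v f d2 -> d1 = d2.
Proof. by move=> [_ <-] [_ <-]. Qed.

End Derive.

Lemma dotpC n (v w : 'rV[R]_n) : dotp v w = dotp w v.
Proof. by rewrite /dotp -[v *m w^T]trmxK mxE trmx_mul trmxK. Qed.

Lemma dotpE n (v w : 'rV[R]_n) : dotp v w = \sum_i v 0 i * w 0 i.
Proof. by rewrite /dotp mxE; apply: eq_bigr => i _; rewrite mxE. Qed.

Lemma dotpDl n (u v w : 'rV[R]_n) : dotp (u + v) w = dotp u w + dotp v w.
Proof. by rewrite /dotp mulmxDl mxE. Qed.

Lemma dotpDr n (u v w : 'rV[R]_n) : dotp w (u + v) = dotp w u + dotp w v.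
Proof. by rewrite dotpC dotpDl !(dotpC w). Qed.

Lemma dotpZl n a (v w : 'rV[R]_n) : dotp (a *: v) w = a * dotp v w.
Proof. by rewrite /dotp -scalemxAl mxE. Qed.

Lemma dotpZr n a (v w : 'rV[R]_n) : dotp w (a *: v) = a * dotp w v.
Proof. by rewrite dotpC dotpZl (dotpC w). Qed.

Lemma dotpNl n (v w : 'rV[R]_n) : dotp (- v) w = - dotp v w.
Proof. by rewrite -scaleN1r dotpZl mulN1r. Qed.

Lemma dotpNr n (v w : 'rV[R]_n) : dotp w (- v) = - dotp w v.
Proof. by rewrite -scaleN1r dotpZr mulN1r. Qed.

Lemma dotpBl n (u v w : 'rV[R]_n) : dotp (u - v) w = dotp u w - dotp v w.
Proof. by rewrite dotpDl dotpNl. Qed.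

Lemma dotp0l n (w : 'rV[R]_n) : dotp 0 w = 0.
Proof. by rewrite -(scale0r 0) dotpZl mul0r. Qed.

Lemma dotp0r n (w : 'rV[R]_n) : dotp w 0 = 0.
Proof. by rewrite dotpC dotp0l. Qed.

Lemma dotp_ge0 n (v : 'rV[R]_n) : 0 <= dotp v v.
Proof. by rewrite dotpE sumr_ge0// => i _; rewrite -expr2 sqr_ge0. Qed.

Lemma dotp_gt0 n (v : 'rV[R]_n) : (0 < dotp v v) = (v != 0).
Proof.
rewrite lt_neqAle dotp_ge0 andbT eq_sym; congr (~~ _); apply/eqP/eqP => [v0|->].
  apply/rowP => i; rewrite mxE; apply/eqP.
  rewrite -[_ == _]orbb -mulf_eq0; apply/eqP; move: i (isT).
  apply: psumr_eq0P => [i _|]; first by rewrite -expr2 sqr_ge0.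
  by rewrite -dotpE v0.
exact: dotp0l.
Qed.

Lemma dotp_mulmxl m n (v : 'rV[R]_m) (A : 'M[R]_(m, n)) w :
  dotp (v *m A) w = dotp v (w *m A^T).
Proof. by rewrite /dotp trmx_mul trmxK mulmxA. Qed.

(** Neighbourhoods are given by the sup norm, whereas the barriers of the maximum principle are
    radial for the Euclidean norm; this bound and [dotp_le_norm] translate between the two. *)
Lemma dotp_norm_le n (v : 'rV[R]_n) : `|v| ^+ 2 <= dotp v v.
Proof.
have [v0|] := eqVneq `|v| 0; first by rewrite v0 expr0n dotp_ge0.
move=> /mx_norm_neq0[[i j] /= E]; have -> : `|v| = `|v i j| := E.
rewrite (ord1 i) dotpE (bigD1 j)//=.
rewrite -normrX ger0_norm ?sqr_ge0// expr2 lerDl sumr_ge0// => k _.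
by rewrite -expr2 sqr_ge0.
Qed.

Lemma dotp_le_norm n (v : 'rV[R]_n) : dotp v v <= n%:R * `|v| ^+ 2.
Proof.
have -> : n%:R = \sum_(i < n) (1 : R) by rewrite sumr_const card_ord.
rewrite dotpE mulr_suml ler_sum// => i _.
rewrite mul1r -expr2 -real_normK ?num_real// ler_pXn2r ?nnegrE//.
rewrite [leRHS]/Num.Def.normr/= mx_normrE.
exact: (le_bigmax _ (fun k : 'I_1 * 'I_n => `|v k.1 k.2|) (0, i)).
Qed.

End MatrixCalculus.

(** * The strong maximum principle *)

Section MaximumPrinciple.
Context {R : realType} {n m : nat}.
Implicit Types (U : set 'rV[R]_n) (F : 'rV[R]_n -> R).
Implicit Types (G : 'rV[R]_n -> 'rV[R]_n) (H : 'rV[R]_n -> 'M[R]_n).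

(** Carrying G and H as explicit data keeps the derivatives of the sum of a function and a barrier
    computable. *)
Definition gradient_hessian_on U F G H : Prop := forall u, U u -> forall v,
  is_derive u v F (dotp v (G u)) /\ is_derive u v G (v *m H u).

(* The second order part is written with a factor E of the inverse metric
   E E^T, which makes it a sum of second derivatives along the columns of E. *)
Definition elliptic_op (E : 'M[R]_(n, m)) (b g : 'rV[R]_n) (h : 'M[R]_n) : R :=
  \tr (E^T *m h *m E) - dotp b g.

Lemma elliptic_opD E b g1 g2 h1 h2 (e : R) :
  elliptic_op E b (g1 + e *: g2) (h1 + e *: h2) =
  elliptic_op E b g1 h1 + e * elliptic_op E b g2 h2.
Proof.
rewrite /elliptic_op dotpDr dotpZr mulmxDr mulmxDl mxtraceD -scalemxAr.
by rewrite -scalemxAl mxtraceZ; ring.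
Qed.

Lemma gradient_hessian_onD U F1 G1 H1 F2 G2 H2 (e : R) :
  gradient_hessian_on U F1 G1 H1 -> gradient_hessian_on U F2 G2 H2 ->
  gradient_hessian_on U (fun x => F1 x + e * F2 x) (fun x => G1 x + e *: G2 x)
    (fun x => H1 x + e *: H2 x).
Proof.
move=> gh1 gh2 u Uu v; have [f1 g1] := gh1 u Uu v; have [f2 g2] := gh2 u Uu v.
split; first by rewrite dotpDr dotpZr; exact: is_deriveD f1 (is_deriveZ _ f2).
by rewrite mulmxDr -scalemxAr; exact: is_deriveD g1 (is_deriveZ _ g2).
Qed.

Lemma gradient_hessian_local_max U F G H u : open U ->
  gradient_hessian_on U F G H -> U u -> (\forall x \near u, F x <= F u) ->
  G u = 0 /\ forall v, dotp v (v *m H u) <= 0.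
Proof.
move=> oU gh Uu mF.
have nU : \forall x \near u, U x by exact: open_nbhs_nbhs.
have nG v : \forall x \near u, dotp v (G x) = 'D_v F x.
  by apply: filterS nU => x /gh/(_ v)[[_ <-]].
have dG v : is_derive u v ('D_v F) (dotp v (v *m H u)).
  apply: (@near_eq_is_derive _ _ _ (fun x => dotp v (G x)) _ _ _ _ (nG v)).
  have := is_derive_dotp (is_derive_cst v u v) (gh u Uu v).2.
  by rewrite dotp0l add0r.
have D v : dotp v (G u) = 0 /\ dotp v (v *m H u) <= 0.
  have [|||e1 e2] := @derive_local_max R _ F u v.
  - by apply: filterS nU => x /gh/(_ v)[[]].
  - by case: (dG v).
  - exact: mF.
  - have [[_ f1] _] := gh u Uu v; rewrite -f1 e1; split => //.
    by have [_ <-] := dG v.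
split=> [|v]; last by have [] := D v.
by apply/eqP/negPn; rewrite -dotp_gt0 (D _).1 ltxx.
Qed.

(** The trace of E^T h E sums the values of the quadratic form h on the columns of E. *)
Lemma elliptic_op_le0 E b h : (forall v, dotp v (v *m h) <= 0) ->
  elliptic_op E b 0 h <= 0.
Proof.
move=> h_le0; rewrite /elliptic_op dotp0r subr0 sumr_le0// => k _.
apply: le_trans (h_le0 (row k E^T)); rewrite dotpC dotpE mxE le_eqVlt.
apply/orP/or_introl/eqP/eq_bigr => j _; congr (_ * _); last by rewrite !mxE.
by rewrite -row_mul [RHS]mxE.
Qed.

(** Its powers replace the exponential in Hopf's comparison function: they are positive inside the
    ball, vanish on its boundary, and have polynomial derivatives. *)
Definition barrier (c : 'rV[R]_n) (r2 : R) x := r2 - dotp (x - c) (x - c).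

Lemma is_derive_barrier c r2 u v :
  is_derive u v (barrier c r2) (- 2 * dotp v (u - c)).
Proof.
have d : is_derive u v (fun x => x - c) v.
  by have := is_deriveB (is_derive_id u v) (is_derive_cst c u v); rewrite subr0.
have := is_deriveB (is_derive_cst r2 u v) (is_derive_dotp d d).
by congr is_derive; rewrite (dotpC (u - c)) sub0r; ring.
Qed.

Lemma barrier_gradient_hessian U c r2 k : gradient_hessian_on U
  (fun x => barrier c r2 x ^+ k.+2)
  (fun x => (- 2 * k.+2%:R * barrier c r2 x ^+ k.+1) *: (x - c))
  (fun x => (4 * k.+2%:R * k.+1%:R * barrier c r2 x ^+ k) *: ((x - c)^T *m (x - c))
            + (- 2 * k.+2%:R * barrier c r2 x ^+ k.+1)%:M).
Proof.
move=> u Uu v.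
have d : is_derive u v (fun x => x - c) v.
  by have := is_deriveB (is_derive_id u v) (is_derive_cst c u v); rewrite subr0.
have db := is_derive_barrier c r2 u v.
have dX j : is_derive u v (fun x => barrier c r2 x ^+ j.+1)
    (- 2 * j.+1%:R * barrier c r2 u ^+ j * dotp v (u - c)).
  have := is_deriveX j.+1 db; congr is_derive; last by rewrite /= /GRing.scale /=; ring.
  by apply/funext => x; elim: (j.+1) => [|i IH]; rewrite ?expr0// !exprS -IH.
split.
  by have := dX k.+1; congr is_derive; rewrite dotpZr; ring.
have := is_derive_fscale (is_deriveZ (- 2 * k.+2%:R) (dX k)) d.
congr is_derive; rewrite mulmxDr -scalemxAr mulmxA mul_mx_scalar; congr (_ + _).
rewrite [v *m _]mx11_scalar mul_scalar_mx scalerA; congr (_ *: _).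
by rewrite /GRing.scale /= /dotp; ring.
Qed.

(** Only the first term in the last factor grows with k; where [(x - c) *m E] is bounded away from
    0, a large exponent makes the whole positive inside the ball. *)
Lemma elliptic_op_barrier E b c r2 k x :
  elliptic_op E b ((- 2 * k.+2%:R * barrier c r2 x ^+ k.+1) *: (x - c))
    ((4 * k.+2%:R * k.+1%:R * barrier c r2 x ^+ k) *: ((x - c)^T *m (x - c))
     + (- 2 * k.+2%:R * barrier c r2 x ^+ k.+1)%:M) =
  2 * k.+2%:R * barrier c r2 x ^+ k *
  (2 * k.+1%:R * dotp ((x - c) *m E) ((x - c) *m E) -
   barrier c r2 x * (\tr (E^T *m E) - dotp b (x - c))).
Proof.
rewrite /elliptic_op dotpZr mulmxDr mulmxDl mxtraceD -scalemxAr -scalemxAl.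
rewrite mxtraceZ mul_mx_scalar -scalemxAl mxtraceZ exprS.
have -> : \tr (E^T *m ((x - c)^T *m (x - c)) *m E) =
    dotp ((x - c) *m E) ((x - c) *m E).
  by rewrite !mulmxA -trmx_mul -mulmxA mxtrace_mulC trace_mx11.
by ring.
Qed.

Lemma continuous_sub_cst (c x : 'rV[R]_n) : {for x, continuous (fun y : 'rV[R]_n => y - c)}.
Proof. by apply: (@continuousB _ _ _ id (cst c)) => //; exact: cst_continuous. Qed.

Lemma continuous_dist (c x : 'rV[R]_n) :
  {for x, continuous (fun y : 'rV[R]_n => dotp (y - c) (y - c))}.
Proof. by apply: continuous_dotp; exact: continuous_sub_cst. Qed.

Lemma compact_annulus (c : 'rV[R]_n) (s r : R) :
  compact [set x | s <= dotp (x - c) (x - c) <= r].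
Proof.
apply: bounded_closed_compact.
  (* Here r bounds a squared distance, and r <= (1 + r)^2 for r >= 0. *)
  exists (1 + r + `|c|); split; first exact: num_real.
  move=> K rK x /= /andP[_ xr].
  have xc : `|x - c| <= 1 + r.
    have r0 : 0 <= r by apply: le_trans xr; exact: dotp_ge0.
    rewrite -(@ler_pXn2r _ 2) ?nnegrE ?addr_ge0//.
    apply: le_trans (dotp_norm_le _) (le_trans xr _); nra.
  rewrite ltW// (le_lt_trans _ rK)// -[x](subrK c).
  by rewrite (le_trans (ler_normD _ _))// lerD2r.
rewrite [X in closed X](_ : _ = (fun x : 'rV[R]_n => dotp (x - c) (x - c)) @^-1` `[s, r]).
  apply: preimage_closed; last exact: interval_closed.
  by move=> x _; exact: continuous_dist.
by apply/seteqP; split => x /=; rewrite in_itv.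
Qed.

(* If F u1 < F u0 with u1 near u0, then on an annulus around u1 containing u0 the
   function F + e * barrier ^+ N, with N large and e small, has a strictly
   positive elliptic_op but would attain its maximum in the interior. *)
Lemma strong_maximum_principle U F G H (E : 'rV[R]_n -> 'M[R]_(n, m))
    (b : 'rV[R]_n -> 'rV[R]_n) (u0 : 'rV[R]_n) :
  open U -> gradient_hessian_on U F G H ->
  (forall u, U u -> {for u, continuous F}) ->
  (forall u, U u -> {for u, continuous E}) ->
  (forall u, U u -> {for u, continuous b}) ->
  (forall u (v : 'rV[R]_n), U u -> v != 0 -> v *m E u != 0) ->
  (forall u, U u -> 0 <= elliptic_op (E u) (b u) (G u) (H u)) ->
  U u0 -> (forall u, U u -> F u <= F u0) -> \forall u \near u0, F u = F u0.
Proof.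
move=> oU gh cF cE cb Einj LF Uu0 maxF.
have /nbhs_normP[d /= d0 dU] : \forall x \near u0, U x by exact: open_nbhs_nbhs.
(* With u1 within k of u0, the Euclidean ball about u1 of squared radius [n.+1%:R * k ^+ 2] contains
   u0, whose squared distance is at most n k^2, and stays within d / 2 of u0 for the sup norm, hence
   in U. *)
pose k := d / (4 * n.+1%:R).
have n0 : (0 : R) < n.+1%:R by [].
have k0 : 0 < k by rewrite divr_gt0// mulr_gt0.
near=> u1.
have u1k : `|u0 - u1| < k by near: u1; exact: (nbhs_ball_norm u0 (PosNum k0)).
apply/eqP; rewrite eq_le maxF; last by near: u1; exact: open_nbhs_nbhs.
have Uu1 : U u1 by near: u1; exact: open_nbhs_nbhs.
rewrite /= leNgt; apply/negP => F10.
pose q x := dotp (x - u1) (x - u1); pose eta := (F u0 - F u1) / 2.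
have eta0 : 0 < eta by rewrite divr_gt0// subr_gt0.
have /nbhs_normP[s0 /= s00 Fs] : \forall x \near u1, F x < F u0 - eta.
  have /cvgr_lt : F x @[x --> u1] --> F u1 by exact: cF.
  by apply; rewrite /eta; lra.
pose s := (s0 / 2) ^+ 2; pose r2 := n.+1%:R * k ^+ 2.
have s_gt0 : 0 < s by rewrite exprn_gt0// divr_gt0.
have r2_gt0 : 0 < r2 by rewrite mulr_gt0// exprn_gt0.
have small x : q x <= s -> F x < F u0 - eta.
  move=> qs; apply: Fs => /=; rewrite /ball_ /= distrC.
  have := le_trans (dotp_norm_le (x - u1)) qs.
  have s0h : 0 <= s0 / 2 by rewrite divr_ge0// ltW.
  rewrite (@ler_pXn2r _ 2) ?nnegrE// => /le_lt_trans; apply.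
  by rewrite ltr_pdivrMr// ltr_pMr// ltr1n.
have large x : q x <= r2 -> U x.
  move=> qr; apply: dU => /=; rewrite /ball_ /=.
  have : `|x - u1| ^+ 2 <= (n.+1%:R * k) ^+ 2.
    apply: le_trans (dotp_norm_le _) (le_trans qr _).
    by rewrite exprMn ler_wpM2r ?sqr_ge0// expr2 ler_pMr// ler1n.
  have nk0 : 0 <= n.+1%:R * k by rewrite mulr_ge0// ltW.
  rewrite (@ler_pXn2r _ 2) ?nnegrE// => xk.
  rewrite -[u0](subrK u1) -addrA (le_lt_trans (ler_normD _ _))//.
  rewrite [`|u1 - x|]distrC.
  have kn : n.+1%:R * k = d / 4 by rewrite /k; move: (n.+1%:R : R) (lt0r_neq0 n0) => N N0; field.
  have kd : k <= d / 4.
    by rewrite -kn ler_pMl// ler1n.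
  lra.
have qu0 : q u0 < r2.
  apply: le_lt_trans (dotp_le_norm _) _.
  apply: (@le_lt_trans _ _ (n%:R * k ^+ 2)).
    by rewrite ler_wpM2l// (@ler_pXn2r _ 2) ?nnegrE// ltW.
  by rewrite ltr_pM2r ?exprn_gt0// ltr_nat.
have sq0 : s <= q u0.
  rewrite leNgt; apply/negP => /ltW/small; lra.
pose K := [set x | s <= q x <= r2].
have K0 : K !=set0 by exists u0; rewrite /K /= sq0 ltW.
have cK : compact K by exact: compact_annulus.
have KU x : K x -> U x by move=> /andP[_ /large].
(* On the annulus x differs from u1, so the injectivity of E bounds |(x - u1) E|^2 below by a
   positive constant [kap]; the inner ball is removed for this reason. *)
have [x1 /[!inE] Kx1 min1] : exists2 c, c \in K & forall t, t \in K ->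
    dotp ((c - u1) *m E c) ((c - u1) *m E c) <= dotp ((t - u1) *m E t) ((t - u1) *m E t).
  apply: compact_EVT_min => //; apply: continuous_in_subspaceT => x /[!inE] /KU Ux.
  have cm : {for x, continuous (fun t : 'rV[R]_n => (t - u1) *m E t)}.
    by apply: (@continuous_mulmx _ _ _ _ _ (fun t : 'rV[R]_n => t - u1));
      [exact: continuous_sub_cst|exact: cE].
  exact: (continuous_dotp cm cm).
set kap := dotp _ _ in min1.
have kap0 : 0 < kap.
  rewrite dotp_gt0 Einj//; first exact: KU.
  rewrite -dotp_gt0; case/andP: Kx1 => + _; exact: lt_le_trans.
pose T x := barrier u1 r2 x * (\tr ((E x)^T *m E x) - dotp (b x) (x - u1)).
have [x2 /[!inE] Kx2 max2] : exists2 c, c \in K & forall t, t \in K -> T t <= T c.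
  apply: compact_EVT_max => //; apply: continuous_in_subspaceT => x /[!inE] /KU Ux.
  have ci := @continuous_sub_cst u1 x.
  apply: (@continuousM _ _ (barrier u1 r2)).
    apply: (@continuousB _ _ _ (cst r2)); first exact: cst_continuous.
    exact: continuous_dist.
  apply: (@continuousB _ _ _ (fun t => \tr ((E t)^T *m E t)) (fun t => dotp (b t) (t - u1))).
    have cET := continuous_trmx (cE _ Ux).
    exact: (continuous_mxtrace (continuous_mulmx cET (cE _ Ux))).
  exact: (continuous_dotp (cb _ Ux) ci).
(* In [elliptic_op_barrier], [T] is the part of the last factor that does not depend on the
   exponent, and [kap] bounds the growing part from below. *)
have [N HN] : exists N : nat, T x2 < 2 * N.+1%:R * kap.
  exists (Num.bound (`|T x2| / kap)).
  have := archi_boundP (_ : 0 <= `|T x2| / kap); rewrite divr_ge0// ?ltW// => /(_ isT).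
  rewrite ltr_pdivrMr// => /(le_lt_trans (ler_norm _)) /lt_le_trans; apply.
  rewrite ler_pM2r//; set M := Num.bound _; rewrite -natrM ler_nat.
  by rewrite (leq_trans (leqnSn _))// leq_pmull.
have Lh x : K x -> 0 < barrier u1 r2 x ->
  0 < elliptic_op (E x) (b x) ((- 2 * N.+2%:R * barrier u1 r2 x ^+ N.+1) *: (x - u1))
    ((4 * N.+2%:R * N.+1%:R * barrier u1 r2 x ^+ N) *: ((x - u1)^T *m (x - u1))
     + (- 2 * N.+2%:R * barrier u1 r2 x ^+ N.+1)%:M).
  move=> Kx bx; rewrite elliptic_op_barrier mulr_gt0 ?mulr_gt0 ?exprn_gt0//.
  rewrite subr_gt0 (le_lt_trans (max2 x _)) ?inE// (lt_le_trans HN)//.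
  by rewrite ler_pM2l ?mulr_gt0// min1 ?inE.
(* On the annulus the perturbation is then at most [eta]; on the inner sphere, where F < F u0 - eta,
   it cannot lift F up to F u0. *)
pose e := eta / r2 ^+ N.+2.
have e0 : 0 < e by rewrite divr_gt0// exprn_gt0.
pose P x := F x + e * barrier u1 r2 x ^+ N.+2.
have bq x : barrier u1 r2 x = r2 - q x by [].
have [xm /[!inE] Kxm maxP] : exists2 c, c \in K & forall t, t \in K -> P t <= P c.
  apply: compact_EVT_max => //; apply: continuous_in_subspaceT => x /[!inE] /KU Ux.
  apply: (@continuousD _ _ _ F); first exact: cF.
  apply: (@continuousM _ _ (cst e)); first exact: cst_continuous.
  apply: (@continuous_comp _ _ _ (barrier u1 r2) (fun y => y ^+ N.+2)).
    by apply: (@continuousB _ _ _ (cst r2)); [exact: cst_continuous|exact: continuous_dist].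
  exact: exprn_continuous.
(* P already exceeds F u0 at u0, which lies strictly inside the outer sphere. So the maximum is
   neither on the outer sphere, where P = F <= F u0, nor on the inner one. *)
have Pm : F u0 < P xm.
  apply: lt_le_trans (maxP u0 _); last by rewrite inE /K /= sq0 ltW.
  by rewrite /P ltrDl mulr_gt0// exprn_gt0// bq subr_gt0.
have qm2 : q xm < r2.
  have /andP[_ qm2] := Kxm; rewrite lt_neqAle qm2 andbT; apply/negP => /eqP E2.
  have := maxF _ (KU _ Kxm).
  by rewrite leNgt; move: Pm; rewrite /P bq E2 subrr expr0n /= mulr0 addr0 => ->.
have qm1 : s < q xm.
  have /andP[qm1 _] := Kxm; rewrite lt_neqAle qm1 andbT; apply/negP => /eqP E2.
  have /small Fm : q xm <= s by rewrite -E2.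
  have : e * barrier u1 r2 xm ^+ N.+2 <= eta.
    rewrite /e mulrAC ler_pdivrMr ?exprn_gt0// ler_pM2l//.
    have b0 : 0 <= barrier u1 r2 xm by rewrite bq subr_ge0 ltW.
    by rewrite (@ler_pXn2r _ N.+2) ?nnegrE ?(ltW r2_gt0)// bq gerBl dotp_ge0.
  by move: Pm; rewrite /P; lra.
have nK : \forall x \near xm, K x.
  have cq : q x @[x --> xm] --> q xm by exact: continuous_dist.
  have n2 : \forall x \near xm, q x < r2 by move/cvgr_lt : cq; apply.
  have n1 : \forall x \near xm, s < q x by move/cvgr_gt : cq; apply.
  by apply: filterS (filterI n1 n2) => x [/= /ltW ? /ltW ?]; apply/andP.
have mP : \forall x \near xm, P x <= P xm.
  by apply: filterS nK => x Kx; apply: maxP; rewrite inE.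
have ghP := gradient_hessian_onD e gh (@barrier_gradient_hessian U u1 r2 N).
have [G0 H0] := gradient_hessian_local_max oU ghP (KU _ Kxm) mP.
have := elliptic_op_le0 (E xm) (b xm) H0; rewrite -[in elliptic_op _ _ 0]G0 elliptic_opD.
rewrite leNgt ltr_wpDl//; first by apply: LF; exact: KU.
by rewrite pmulr_rgt0//; apply: Lh => //; rewrite bq subr_gt0.
Unshelve. all: by end_near. Qed.

End MaximumPrinciple.

(** * Linear algebra of C^2 *)

Section LagrangianFrames.
Context {R : realType}.

Lemma gram_unitmx m n (P : 'M[R]_(m, n)) :
  (forall x : 'rV_m, x *m P = 0 -> x = 0) -> P *m P^T \in unitmx.
Proof.
move=> Pinj; rewrite -row_free_unit; apply/inj_row_free => x xPP.
apply: Pinj; apply/eqP/negPn; rewrite -dotp_gt0.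
by rewrite dotp_mulmxl -mulmxA mulmxA -[x *m P *m _]mulmxA xPP /dotp trmx0 mulmx0 mxE ltxx.
Qed.

Section Cplx.
Context {n : nat}.
Implicit Types (v w z : 'rV[R]_(n + n)).

Definition cplxJmx : 'M[R]_(n + n) := block_mx 0 1%:M (- 1%:M) 0.

Lemma cplxJE z : cplxJ z = z *m cplxJmx.
Proof.
rewrite -{2}[z]hsubmxK mul_row_block !mulmx0 mulmxN !mulmx1.
by rewrite addr0 add0r.
Qed.

Lemma cplxJD v w : cplxJ (v + w) = cplxJ v + cplxJ w.
Proof. by rewrite !cplxJE mulmxDl. Qed.

Lemma cplxJN v : cplxJ (- v) = - cplxJ v.
Proof. by rewrite !cplxJE mulNmx. Qed.

Lemma cplxJ0 : cplxJ 0 = 0 :> 'rV[R]_(n + n).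
Proof. by rewrite cplxJE mul0mx. Qed.

Lemma cplxJZ a v : cplxJ (a *: v) = a *: cplxJ v.
Proof. by rewrite !cplxJE scalemxAl. Qed.

Lemma cplxJB v w : cplxJ (v - w) = cplxJ v - cplxJ w.
Proof. by rewrite cplxJD cplxJN. Qed.

Lemma cplxJK v : cplxJ (cplxJ v) = - v.
Proof. by rewrite {1}/cplxJ row_mxKr row_mxKl -opp_row_mx hsubmxK. Qed.

Lemma tr_cplxJmx : cplxJmx^T = - cplxJmx.
Proof.
by rewrite /cplxJmx tr_block_mx !linear0 linearN /= trmx1 opp_block_mx opprK !oppr0.
Qed.

Lemma dotp_cplxJl v w : dotp (cplxJ v) w = - dotp v (cplxJ w).
Proof. by rewrite !cplxJE dotp_mulmxl tr_cplxJmx mulmxN dotpNr. Qed.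

Lemma dotp_cplxJr v w : dotp v (cplxJ w) = - dotp (cplxJ v) w.
Proof. by rewrite dotp_cplxJl opprK. Qed.

Lemma dotp_cplxJ v w : dotp (cplxJ v) (cplxJ w) = dotp v w.
Proof. by rewrite dotp_cplxJl cplxJK dotpNr opprK. Qed.

Lemma dotp_cplxJ0 v : dotp (cplxJ v) v = 0.
Proof.
have := dotp_cplxJl v v; rewrite [dotp v _]dotpC => /eqP.
by rewrite -subr_eq0 opprK -mulr2n mulrn_eq0 => /eqP.
Qed.

(* R^(n + n) is the orthogonal sum of a Lagrangian subspace and its image by J. *)
Lemma lagrangian_frame (P : 'M[R]_(n, n + n)) z :
  P *m P^T \in unitmx -> P *m cplxJmx *m P^T = 0 ->
  z = z *m P^T *m invmx (P *m P^T) *m P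
      - cplxJ (cplxJ z *m P^T *m invmx (P *m P^T) *m P).
Proof.
move=> gU lagP; pose K := invmx (P *m P^T).
pose F := col_mx P (P *m cplxJmx).
have JJ : cplxJmx *m cplxJmx^T = 1%:M :> 'M[R]_(n + n).
  rewrite tr_cplxJmx mulmxN mulmx_block !mulmx0 !mul0mx mul1mx mulmx1 !addr0 !add0r.
  by rewrite opp_block_mx opprK oppr0 -scalar_mx_block.
have lagP' : P *m (P *m cplxJmx)^T = 0.
  by rewrite trmx_mul tr_cplxJmx mulNmx mulmxN mulmxA lagP oppr0.
(* P and P J have the same Gram matrix and mutually orthogonal rows, so the square matrix stacking
   them has this explicit right inverse, which is also a left inverse. *)
have FF : F *m (F^T *m block_mx K 0 0 K) = 1%:M.
  rewrite mulmxA tr_col_mx mul_col_row lagP lagP' trmx_mul mulmxA.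
  rewrite -[P *m _ *m _]mulmxA JJ mulmx1 mulmx_block !mul0mx !mulmx0 addr0 add0r.
  by rewrite mulmxV// add0r -scalar_mx_block.
have := mulmx1C FF => E; rewrite -[LHS]mulmx1 -E.
rewrite tr_col_mx mul_row_block !mulmx0 addr0 add0r mul_row_col mulmxDr !mulmxA.
congr (_ + _); rewrite !cplxJE trmx_mul tr_cplxJmx !(mulmxN, mulNmx) !mulmxA.
by [].
Qed.

(** In [lagrangian_frame] for J z the second summand involves J (J z) = - z, which has no component
    along P. Applied to the position vector, it shows that J f is tangent. *)
Lemma lagrangian_normal (P : 'M[R]_(n, n + n)) z :
  P *m P^T \in unitmx -> P *m cplxJmx *m P^T = 0 -> z *m P^T = 0 ->
  cplxJ z = cplxJ z *m P^T *m invmx (P *m P^T) *m P.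
Proof.
move=> gU lagP zP; rewrite {1}(lagrangian_frame (cplxJ z) gU lagP) cplxJK.
by rewrite !mulNmx zP !mul0mx !oppr0 cplxJ0 subr0.
Qed.

End Cplx.
End LagrangianFrames.

(** * Right multiplication by imaginary quaternions on C^2 *)

Section Quaternions.
Context {R : realType}.
Implicit Types (z v w : 'rV[R]_(2 + 2)) (mu nu : 'rV[R]_3).

Definition row2 (a b : R) : 'rV[R]_2 := \row_j (if j == 0 then a else b).
Definition mx2 (a b c d : R) : 'M[R]_2 :=
  \matrix_(i, j) (if i == 0 then row2 a b else row2 c d) 0 j.
(** The point (a + i c, b + i d) of C^2; vector identities split into four polynomial ones for
    [ring]. *)
Definition quad (a b c d : R) : 'rV[R]_(2 + 2) := row_mx (row2 a b) (row2 c d).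

Lemma row2K (x : 'rV[R]_2) : x = row2 (x 0 0) (x 0 1).
Proof.
apply/rowP => j; rewrite !mxE; case: j => [[|[|]]] //= jlt.
  by congr (x _ _); apply/val_inj.
by congr (x _ _); apply/val_inj.
Qed.

Lemma quadP z : z = quad (lsubmx z 0 0) (lsubmx z 0 1) (rsubmx z 0 0) (rsubmx z 0 1).
Proof. by rewrite /quad -!row2K hsubmxK. Qed.

Lemma row2_eq a b a' b' : a = a' -> b = b' -> row2 a b = row2 a' b'.
Proof. by move=> -> ->. Qed.

Lemma quad_eq a b c d a' b' c' d' : a = a' -> b = b' -> c = c' -> d = d' ->
  quad a b c d = quad a' b' c' d'.
Proof. by move=> -> -> -> ->. Qed.

Lemma row2_mul x y a b c d :
  row2 x y *m mx2 a b c d = row2 (x * a + y * c) (x * b + y * d).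
Proof.
by apply/rowP => j; rewrite !mxE !big_ord_recl big_ord0 !mxE /= addr0; case: ifP.
Qed.

Lemma tr_mx2 a b c d : (mx2 a b c d)^T = mx2 a c b d.
Proof.
apply/matrixP => i j; rewrite !mxE.
by case: ifP => i0; case: ifP => j0; rewrite !mxE ?i0 ?j0.
Qed.

Lemma row2D a b c d : row2 a b + row2 c d = row2 (a + c) (b + d).
Proof. by apply/rowP => j; rewrite !mxE; case: ifP. Qed.

Lemma row2Z x a b : x *: row2 a b = row2 (x * a) (x * b).
Proof. by apply/rowP => j; rewrite !mxE; case: ifP. Qed.

Lemma quadD a b c d a' b' c' d' : quad a b c d + quad a' b' c' d' =
  quad (a + a') (b + b') (c + c') (d + d').
Proof. by rewrite /quad add_row_mx !row2D. Qed.

Lemma quadZ x a b c d : x *: quad a b c d = quad (x * a) (x * b) (x * c) (x * d).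
Proof. by rewrite /quad scale_row_mx !row2Z. Qed.

Lemma quadB a b c d a' b' c' d' : quad a b c d - quad a' b' c' d' =
  quad (a - a') (b - b') (c - c') (d - d').
Proof.
by rewrite -[quad a' _ _ _]scale1r -scaleNr quadZ quadD; apply: quad_eq; ring.
Qed.

Lemma dotp_quad a b c d a' b' c' d' :
  dotp (quad a b c d) (quad a' b' c' d') = a * a' + b * b' + c * c' + d * d'.
Proof.
rewrite dotpE big_split_ord /= !big_ord_recl !big_ord0.
by rewrite !row_mxEl !row_mxEr !mxE /= !addr0 !addrA.
Qed.

Lemma cplxJ_quad a b c d : cplxJ (quad a b c d) = quad (- c) (- d) a b.
Proof.
rewrite /cplxJ row_mxKr row_mxKl -scaleN1r row2Z.
by apply: quad_eq; rewrite ?mulN1r.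
Qed.

(* The skew-Hermitian traceless matrices; identifying C^2 with the quaternions
   so that [cplxJ] is left multiplication by i, these are the right
   multiplications by imaginary quaternions. *)
Definition su2mx (mu : 'rV[R]_3) : 'M[R]_(2 + 2) :=
  let a := mu 0 0 in let b := mu 0 1 in let c := mu 0 2%:R in
  block_mx (mx2 0 (- b) b 0) (mx2 a c c (- a))
    (mx2 (- a) (- c) (- c) a) (mx2 0 (- b) b 0).

Lemma su2mx_quad x1 x2 y1 y2 mu : quad x1 x2 y1 y2 *m su2mx mu =
  let a := mu 0 0 in let b := mu 0 1 in let c := mu 0 2%:R in
  quad (x2 * b - y1 * a - y2 * c) (y2 * a - x1 * b - y1 * c)
    (x1 * a + x2 * c + y2 * b) (x1 * c - x2 * a - y1 * b).
Proof.
rewrite /quad /su2mx /= mul_row_block !row2_mul !row2D.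
by congr row_mx; apply: row2_eq; ring.
Qed.

Lemma tr_su2mx mu : (su2mx mu)^T = - su2mx mu.
Proof.
rewrite /su2mx tr_block_mx opp_block_mx.
have N a b c d : - mx2 a b c d = mx2 (- a) (- b) (- c) (- d).
  by apply/matrixP => i j; rewrite !mxE; case: ifP => _; rewrite !mxE; case: ifP.
by rewrite !tr_mx2 !N !opprK !oppr0.
Qed.

Lemma su2mxZ x mu z : z *m su2mx (x *: mu) = x *: (z *m su2mx mu).
Proof.
by rewrite (quadP z) !su2mx_quad quadZ !mxE /=; apply: quad_eq; ring.
Qed.

Lemma cplxJ_su2mx z mu : cplxJ (z *m su2mx mu) = cplxJ z *m su2mx mu.
Proof.
by rewrite (quadP z) su2mx_quad !cplxJ_quad su2mx_quad /=; apply: quad_eq; ring.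
Qed.

Lemma dotp_su2mxl v w mu : dotp (v *m su2mx mu) w = - dotp v (w *m su2mx mu).
Proof. by rewrite dotp_mulmxl tr_su2mx mulmxN dotpNr. Qed.

Lemma dotp_su2mx0 v mu : dotp v (v *m su2mx mu) = 0.
Proof.
have := dotp_su2mxl v v mu; rewrite [dotp (_ *m _) _]dotpC => /eqP.
by rewrite -subr_eq0 opprK -mulr2n mulrn_eq0 => /eqP.
Qed.

Lemma dotp3 mu nu : dotp mu nu =
  mu 0 0 * nu 0 0 + mu 0 1 * nu 0 1 + mu 0 2%:R * nu 0 2%:R.
Proof.
have e1 : lift ord0 ord0 = 1 :> 'I_3 by apply/val_inj.
have e2 : lift ord0 (lift ord0 ord0) = 2%:R :> 'I_3 by apply/val_inj.
by rewrite dotpE !big_ord_recl big_ord0 addr0 addrA e1 e2.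
Qed.

(** Multiplicativity of the quaternion norm, polarised in the imaginary right factor. *)
Lemma dotp_su2mx z mu nu :
  dotp (z *m su2mx mu) (z *m su2mx nu) = dotp mu nu * dotp z z.
Proof.
by rewrite (quadP z) !su2mx_quad /= !dotp_quad dotp3; ring.
Qed.

Lemma su2mxK z mu : z *m su2mx mu *m su2mx mu = - dotp mu mu *: z.
Proof.
rewrite (quadP z) !su2mx_quad /= quadZ dotp3.
by apply: quad_eq; ring.
Qed.

(* On vectors v orthogonal to w, the imaginary quaternion by which w has to be
   multiplied to give |w|^2 v; see moment_su2mx. *)
Definition moment v w : 'rV[R]_3 := \row_a dotp v (w *m su2mx (delta_mx 0 a)).

(** For w nonzero, w and the three vectors [w *m su2mx (delta_mx 0 a)] form an orthogonal basis of
    vectors of length |w|; this is the expansion of v in it, times |w|^2. *)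
Lemma moment_su2mx v w : w *m su2mx (moment v w) = dotp w w *: v - dotp v w *: w.
Proof.
rewrite (quadP v) (quadP w) su2mx_quad /= !mxE !su2mx_quad /= !dotp_quad.
rewrite !quadZ quadB !mxE /=.
by apply: quad_eq; ring.
Qed.

(** A traceless Hermitian form on C^2; for [mu = delta_mx 0 0] it is |z_1|^2 - |z_2|^2. *)
Definition torus_form mu z : R := dotp (cplxJ z) (z *m su2mx mu).

Lemma torus_formZ x mu z : torus_form (x *: mu) z = x * torus_form mu z.
Proof. by rewrite /torus_form su2mxZ dotpZr. Qed.

End Quaternions.

(** * Charts of an immersed submanifold *)

Section Continuity.
Context {R : realType}.

Lemma near_eq_continuous {T W : topologicalType} (f g : T -> W) x :
  (\forall y \near x, f y = g y) -> {for x, continuous f} ->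
  {for x, continuous g}.
Proof.
move=> fg cf; apply: (@cvg_trans _ (f @ x)); first exact: near_eq_cvg.
by rewrite -(nbhs_singleton fg).
Qed.

Lemma continuous_prodr {T : topologicalType} (I : Type) (r : seq I)
    (f : I -> T -> R) x :
  (forall i, {for x, continuous (f i)}) ->
  {for x, continuous (fun y => \prod_(i <- r) f i y : R)}.
Proof.
move=> cf; elim: r => [|i r IH].
  by apply: (@continuous_ext T R (fun=> 1)) => [y|]; [rewrite big_nil|exact: cst_continuous].
apply: (@continuous_ext _ _ (f i \* fun y => \prod_(j <- r) f j y)).
  by move=> y; rewrite big_cons.
exact: (@continuousM _ _ (f i) _ _ (cf i) IH).
Qed.

Lemma continuous_det {T : topologicalType} n (A : T -> 'M[R]_n) x :
  {for x, continuous A} -> {for x, continuous (fun y => \det (A y))}.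
Proof.
move=> /continuous_mxP cA.
apply: (@continuous_ext _ R (fun y =>
  \sum_(s : {perm 'I_n}) (-1) ^+ s * \prod_i A y i (s i))) => //.
apply: continuous_sumr => s.
apply: (@continuousM R T (fun=> (-1) ^+ s) (fun y => \prod_i A y i (s i))).
  exact: cst_continuous.
by apply: continuous_prodr => i; exact: cA.
Qed.

Lemma continuous_invmx {T : topologicalType} n (A : T -> 'M[R]_n) x :
  A x \in unitmx -> {for x, continuous A} ->
  {for x, continuous (fun y => invmx (A y))}.
Proof.
move=> Ax cA; have cd := continuous_det cA.
(* The default value of [invmx] at a singular matrix is the matrix itself, so the cofactor formula
   is available only near x. *)
have nU : \forall y \near x, A y \in unitmx.
  have dx : \det (A x) != 0 by rewrite -unitfE -unitmxE.
  have : \forall y \near x, \det (A y) != 0 by exact: (cvgr_neq0 _ cd dx).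
  by apply: filterS => y; rewrite unitmxE unitfE.
apply: (@near_eq_continuous _ _ (fun y => (\det (A y))^-1 *: \adj (A y))).
  by apply: filterS nU => y Ay; rewrite /invmx Ay.
apply/continuous_mxP => i j.
apply: (@continuous_ext _ _ (fun y => (\det (A y))^-1 * cofactor (A y) j i)).
  by move=> y; rewrite !mxE.
apply: (@continuousM _ _ (fun y => (\det (A y))^-1)).
  by apply: (@continuousV _ _ (fun y => \det (A y))) => //; rewrite -unitfE -unitmxE.
apply: (@continuousM _ _ (cst ((-1) ^+ (j + i)))); first exact: cst_continuous.
apply: continuous_det; apply/continuous_mxP => k l.
apply: (@continuous_ext _ _ (fun y => A y (lift j k) (lift i l))).
  by move=> y; rewrite !mxE.
by move/continuous_mxP : cA; apply.
Qed.

End Continuity.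

(* Locked: unification otherwise unfolds these derivatives into limits. *)
HB.lock Definition partial1 (R : realType) n m (f : 'rV[R]_n -> 'rV[R]_m)
    (i : 'I_n) (u : 'rV[R]_n) : 'rV[R]_m :=
  'D_(delta_mx 0 i : 'rV[R]_n) f u.

HB.lock Definition partial2 (R : realType) n m (f : 'rV[R]_n -> 'rV[R]_m)
    (i j : 'I_n) (u : 'rV[R]_n) : 'rV[R]_m :=
  'D_(delta_mx 0 i : 'rV[R]_n) ('D_(delta_mx 0 j : 'rV[R]_n) f) u.

Section Charts.
Context {R : realType} {n m : nat}.
Variables (U : set 'rV[R]_n) (f : 'rV[R]_n -> 'rV[R]_m).
Hypothesis oU : open U.
Hypothesis smf : smooth_on U f.
Implicit Types (u v w : 'rV[R]_n) (i j : 'I_n).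

Local Notation partial1 := (partial1 f).
Local Notation partial2 := (partial2 f).
Definition tangent_mx u : 'M[R]_(n, m) := \matrix_i partial1 i u.

Lemma near_chart u : U u -> \forall x \near u, U x.
Proof. by move=> Uu; apply: open_nbhs_nbhs. Qed.

Lemma chart_differentiable u : U u -> differentiable f u.
Proof. by have [+ _] := smf 1; apply. Qed.

Lemma chart_differentiable1 u v : U u -> differentiable ('D_v f) u.
Proof. by have [_ /(_ v)[+ _]] := smf 2; apply. Qed.

Lemma continuous_derive2 u v w : U u -> {for u, continuous ('D_w ('D_v f))}.
Proof. by have [_ /(_ v)[_ /(_ w)]] := smf 2; apply. Qed.

Lemma is_derive_jacobian k (g : 'rV[R]_n -> 'rV[R]_k) u v :
  differentiable g u -> is_derive u v g (v *m jacobian g u).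
Proof.
by move=> dg; split; [exact: diff_derivable|rewrite deriveEjacobian].
Qed.

Lemma row_jacobian k (g : 'rV[R]_n -> 'rV[R]_k) u i : differentiable g u ->
  row i (jacobian g u) = 'D_(delta_mx 0 i : 'rV[R]_n) g u.
Proof. by move=> dg; rewrite rowE -deriveEjacobian. Qed.

Lemma jacobianE u : U u -> jacobian f u = tangent_mx u.
Proof.
move=> Uu; apply/row_matrixP => i; rewrite rowK partial1.unlock row_jacobian//.
exact: chart_differentiable.
Qed.

Lemma is_derive_chart u v : U u -> is_derive u v f (v *m tangent_mx u).
Proof.
by move=> Uu; rewrite -jacobianE//; apply/is_derive_jacobian/chart_differentiable.
Qed.

Lemma is_derive_partial1 u v j : U u ->
  is_derive u v (partial1 j) (\sum_i v 0 i *: partial2 i j u).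
Proof.
move=> Uu; have d := chart_differentiable1 (delta_mx 0 j) Uu.
have := is_derive_jacobian v d; congr is_derive.
  by apply/funext => x; rewrite partial1.unlock.
rewrite mulmx_sum_row; apply: eq_bigr => i _; congr (_ *: _).
by rewrite row_jacobian// partial2.unlock.
Qed.

Lemma row_tangent_mx u i : row i (tangent_mx u) = partial1 i u.
Proof. exact: rowK. Qed.

Lemma second_ffE u i j : second_ff f u i j = normal_part f u (partial2 i j u).
Proof. by rewrite partial2.unlock. Qed.

Lemma mul_tangent_mx u v : v *m tangent_mx u = \sum_i v 0 i *: partial1 i u.
Proof. by rewrite mulmx_sum_row; apply: eq_bigr => i _; rewrite rowK. Qed.

Lemma continuous_chart u : U u -> {for u, continuous f}.
Proof. by move=> Uu; apply/differentiable_continuous/chart_differentiable. Qed.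

Lemma continuous_tangent_mx u : U u -> {for u, continuous tangent_mx}.
Proof.
move=> Uu; apply/continuous_mxP => i j.
apply: (@continuous_ext _ _ (fun y => partial1 i y 0 j)) => [y|].
  by rewrite mxE.
have : {for u, continuous (partial1 i)}.
  apply: (@continuous_ext _ _ ('D_(delta_mx 0 i : 'rV[R]_n) f)).
    by move=> y; rewrite partial1.unlock.
  exact/differentiable_continuous/chart_differentiable1.
by move/continuous_mxP; apply.
Qed.

Lemma partial2C u i j : U u -> partial2 i j u = partial2 j i u.
Proof.
move=> Uu; apply/rowP => k.
(* [derive_comm] concerns real functions. The derivatives of the coordinate F are known to be
   coordinates of those of f only on U, hence the equalities near a point. *)
pose F x := f x 0 k.
have D1 v x : U x -> is_derive x v F ('D_v f x 0 k).
  move=> Ux; have /derivableP/is_derive_mxP : derivable f x v.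
    exact/diff_derivable/chart_differentiable.
  exact.
have nD1 v x : U x -> \forall y \near x, 'D_v f y 0 k = 'D_v F y.
  by move=> /near_chart; apply: filterS => y /(D1 v)[_ <-].
have D2 v w x : U x -> is_derive x w ('D_v F) ('D_w ('D_v f) x 0 k).
  move=> Ux; apply: (@near_eq_is_derive _ _ _ (fun y => 'D_v f y 0 k)).
    exact: nD1.
  have /derivableP/is_derive_mxP : derivable ('D_v f) x w.
    exact/diff_derivable/chart_differentiable1.
  exact.
have cD2 v w : {for u, continuous ('D_w ('D_v F))}.
  apply: (@near_eq_continuous _ _ (fun y => 'D_w ('D_v f) y 0 k)).
    by apply: filterS (near_chart Uu) => y /(D2 v w)[_ <-].
  by have /continuous_mxP := @continuous_derive2 u v w Uu; apply.
rewrite partial2.unlock; set v := delta_mx 0 i; set w := delta_mx 0 j.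
have [_ E1] := D2 w v u Uu; have [_ E2] := D2 v w u Uu.
apply: etrans (esym E1) _; apply: etrans _ E2; apply: derive_comm; [|exact: cD2|exact: cD2].
apply: filterS (near_chart Uu) => x Ux.
split; [case: (D1 w x Ux)|case: (D1 v x Ux)|case: (D2 w v x Ux)|
  case: (D2 v w x Ux)]; by [].
Qed.

Definition half_norm2 u : R := 2^-1 * dotp (f u) (f u).
Definition half_norm2_hessian u : 'M[R]_n :=
  \matrix_(i, j) (dotp (partial2 i j u) (f u) + dotp (partial1 i u) (partial1 j u)).

Definition half_norm2_gradient u : 'rV[R]_n := f u *m (tangent_mx u)^T.

Lemma half_norm2_gradient_hessian :
  gradient_hessian_on U half_norm2 half_norm2_gradient half_norm2_hessian.
Proof.
move=> u Uu v; have df := is_derive_chart v Uu; split.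
  have := is_deriveZ 2^-1 (is_derive_dotp df df); congr is_derive.
  rewrite (dotpC (f u)) -dotp_mulmxl /GRing.scale /=.
  rewrite -[dotp _ _ + _]mulr2n mulrnAr -mulrnAl -[_ *+ 2]mulr_natr.
  by rewrite mulVf ?mul1r// pnatr_eq0.
apply/is_derive_mxP => i j; rewrite (ord1 i).
have -> : (fun y => half_norm2_gradient y 0 j) = (fun y => dotp (f y) (partial1 j y)).
  apply/funext => y; rewrite dotpE mxE; apply: eq_bigr => k _.
  by rewrite !mxE.
have := is_derive_dotp df (is_derive_partial1 v j Uu); congr is_derive.
rewrite mul_tangent_mx mxE dotpC (dotpC (f u)).
have lin (g : 'I_n -> 'rV[R]_m) y :
    dotp (\sum_i v 0 i *: g i) y = \sum_i v 0 i * dotp (g i) y.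
  rewrite /dotp mulmx_suml summxE; apply: eq_bigr => k _.
  by rewrite -scalemxAl mxE.
rewrite dotpC !lin -big_split; apply: eq_bigr => k _.
by rewrite !mxE addrC mulrDr.
Qed.

Lemma metric_unitmx u : U u -> injective ('d f u) -> metric f u \in unitmx.
Proof.
move=> Uu inj; apply: gram_unitmx => x; rewrite -deriveEjacobian; last first.
  exact: chart_differentiable.
rewrite deriveE; last exact: chart_differentiable.
by rewrite -(linear0 ('d f u)) => /inj.
Qed.

Hypothesis imm : forall u, U u -> injective ('d f u).

(* sum_ij g^ij (d_i d_j f)^T in the coordinate basis, so that elliptic_op is the
   Laplace-Beltrami operator of the induced metric. *)
Definition laplacian_drift u : 'rV[R]_n := \sum_i \sum_j
  invmx (metric f u) i j *: (partial2 i j u *m (jacobian f u)^T *m invmx (metric f u)).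

Lemma tr_metric u : (metric f u)^T = metric f u.
Proof. by rewrite /metric trmx_mul trmxK. Qed.

(** This is Delta (|f|^2 / 2) = n + <H, f>: the first derivatives contribute the trace of g^-1 g,
    and the drift removes the tangential part of the second derivatives. With P the Jacobian, the
    factor E = g^-1 P satisfies E E^T = g^-1, so no square root of the metric has to be
    extracted. *)
Lemma laplacian_half_norm2 u : U u ->
  elliptic_op (invmx (metric f u) *m jacobian f u) (laplacian_drift u)
    (half_norm2_gradient u) (half_norm2_hessian u) =
  n%:R + dotp (mean_curvature f u) (f u).
Proof.
move=> Uu; have gU := metric_unitmx Uu (imm Uu).
set K := invmx _; have KT : K^T = K by rewrite /K trmx_inv tr_metric.
have sumE (B : 'M[R]_n) : \sum_i \sum_j K i j * B i j = \tr (B *m K).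
  apply: eq_bigr => i _; rewrite mxE; apply: eq_bigr => j _.
  by rewrite -[in RHS]KT mxE mulrC.
rewrite /elliptic_op trmx_mul KT -!mulmxA mxtrace_mulC -!mulmxA.
rewrite -/(metric f u) mulVmx// mulmx1 mxtrace_mulC -sumE.
have -> : \sum_i \sum_j K i j * half_norm2_hessian u i j =
    \sum_i \sum_j K i j * dotp (partial2 i j u) (f u) + n%:R.
  rewrite -mxtrace1 -(mulmxV gU) -sumE -big_split; apply: eq_bigr => i _.
  rewrite -big_split; apply: eq_bigr => j _; rewrite mxE mulrDr.
  congr (_ + _ * _); rewrite dotpE /metric jacobianE// !mxE.
  by apply: eq_bigr => k _; rewrite !mxE.
rewrite addrAC addrC; congr (_ + _).
rewrite /mean_curvature /laplacian_drift -/K.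
have dsum d (g : 'I_n -> 'I_n -> 'rV[R]_d) y :
    dotp (\sum_i \sum_j K i j *: g i j) y = \sum_i \sum_j K i j * dotp (g i j) y.
  rewrite /dotp mulmx_suml summxE; apply: eq_bigr => i _.
  rewrite mulmx_suml summxE; apply: eq_bigr => j _.
  by rewrite -scalemxAl mxE.
rewrite !dsum -sumrB; apply: eq_bigr => i _; rewrite -sumrB; apply: eq_bigr => j _.
rewrite -mulrBr; congr (_ * _); rewrite second_ffE /normal_part dotpBl.
by rewrite [in RHS]dotp_mulmxl /half_norm2_gradient -jacobianE.
Qed.

Lemma continuous_jacobian u : U u -> {for u, continuous (jacobian f)}.
Proof.
move=> Uu; apply: near_eq_continuous (continuous_tangent_mx Uu).
by apply: filterS (near_chart Uu) => y Uy; rewrite jacobianE.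
Qed.

Lemma continuous_inv_metric u : U u ->
  {for u, continuous (fun x => invmx (metric f x))}.
Proof.
move=> Uu; apply: continuous_invmx; first exact/metric_unitmx/imm.
have cP := continuous_jacobian Uu.
exact: (continuous_mulmx cP (continuous_trmx cP)).
Qed.

Lemma continuous_laplacian_drift u : U u -> {for u, continuous laplacian_drift}.
Proof.
move=> Uu; apply/continuous_mxP => a b.
have cK := continuous_inv_metric Uu.
apply: (@continuous_ext _ R (fun y =>
  \sum_i \sum_j invmx (metric f y) i j *
    (partial2 i j y *m (jacobian f y)^T *m invmx (metric f y)) a b)).
  move=> y; rewrite summxE; apply: eq_bigr => i _; rewrite summxE.
  by apply: eq_bigr => j _; rewrite [RHS]mxE.
apply: continuous_sumr => i; apply: continuous_sumr => j.
apply: (@continuousM _ _ (fun y => invmx (metric f y) i j)).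
  by move/continuous_mxP : cK; apply.
have cP := continuous_trmx (continuous_jacobian Uu).
have c2 : {for u, continuous (partial2 i j)}.
  by rewrite partial2.unlock; exact: continuous_derive2.
by have /continuous_mxP := continuous_mulmx (continuous_mulmx c2 cP) cK; apply.
Qed.

Lemma half_norm2_local_min u : U u -> (\forall x \near u, half_norm2 u <= half_norm2 x) ->
  0 <= n%:R + dotp (mean_curvature f u) (f u).
Proof.
move=> Uu minu; rewrite -laplacian_half_norm2//.
(* The minimum is treated as a maximum of [0 + (-1) * half_norm2], the shape that
   [gradient_hessian_onD] handles. *)
have gh0 : gradient_hessian_on U (fun=> 0) (fun=> 0) (fun=> 0).
  move=> x _ v; rewrite dotp0r mulmx0; split; exact: is_derive_cst.
have gh := gradient_hessian_onD (-1) gh0 half_norm2_gradient_hessian.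
have [|G0 H0] := gradient_hessian_local_max oU gh Uu.
  by apply: filterS minu => x; rewrite !add0r !mulN1r lerN2.
have := elliptic_op_le0 (invmx (metric f u) *m jacobian f u) (laplacian_drift u) H0.
rewrite -[in elliptic_op _ _ 0]G0 elliptic_opD mulN1r.
rewrite /elliptic_op mulmx0 mul0mx mxtrace0 dotp0r subr0 add0r.
by rewrite oppr_le0.
Qed.

Lemma half_norm2_local_max u : (forall x, U x ->
    0 <= n%:R + dotp (mean_curvature f x) (f x)) ->
  U u -> (forall x, U x -> half_norm2 x <= half_norm2 u) ->
  \forall x \near u, half_norm2 x = half_norm2 u.
Proof.
move=> LF Uu maxu.
have c1 x : U x -> {for x, continuous half_norm2}.
  move=> Ux; apply: (@continuousM _ _ (fun=> 2^-1)); first exact: cst_continuous.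
  have cf := continuous_chart Ux; exact: (continuous_dotp cf cf).
have c2 x : U x -> {for x, continuous (fun x => invmx (metric f x) *m jacobian f x)}.
  by move=> Ux; exact: (continuous_mulmx (continuous_inv_metric Ux) (continuous_jacobian Ux)).
have inj x (v : 'rV[R]_n) : U x -> v != 0 -> v *m (invmx (metric f x) *m jacobian f x) != 0.
  move=> Ux; apply: contra_neq => vKP; have gU := metric_unitmx Ux (imm Ux).
  rewrite -[v]mulmx1 -(mulVmx gU) {2}/metric (mulmxA (invmx _)) (mulmxA v).
  by rewrite vKP mul0mx.
have L0 x : U x -> 0 <= elliptic_op (invmx (metric f x) *m jacobian f x)
    (laplacian_drift x) (half_norm2_gradient x) (half_norm2_hessian x).
  by move=> Ux; rewrite laplacian_half_norm2// LF.
exact: (strong_maximum_principle oU half_norm2_gradient_hessian c1 c2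
  continuous_laplacian_drift inj L0 Uu maxu).
Qed.

Lemma normal_part_tangent u (w : 'rV[R]_m) : U u ->
  normal_part f u w *m (jacobian f u)^T = 0.
Proof.
move=> Uu; rewrite /normal_part mulmxBl -!mulmxA.
by rewrite mulVmx ?mulmx1 ?subrr// metric_unitmx//; exact: imm.
Qed.

Lemma mean_curvature_tangent u : U u ->
  mean_curvature f u *m (jacobian f u)^T = 0.
Proof.
move=> Uu; rewrite /mean_curvature mulmx_suml big1// => i _.
rewrite mulmx_suml big1// => j _.
by rewrite -scalemxAl normal_part_tangent// scaler0.
Qed.

Lemma dotp_normal_part u (v w : 'rV[R]_m) : w *m (jacobian f u)^T = 0 ->
  dotp (normal_part f u v) w = dotp v w.
Proof.
by move=> wP; rewrite /normal_part dotpBl dotp_mulmxl wP dotp0r subr0.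
Qed.

Lemma soliton_dotp u a : U u -> mean_curvature f u != 0 -> a != 0 ->
  - ((dotp (mean_curvature f u) (mean_curvature f u))^-1 *: mean_curvature f u) =
    a *: normal_part f u (f u) ->
  dotp (mean_curvature f u) (f u) = - a^-1.
Proof.
move=> Uu; set H := mean_curvature f u => H0 a0 E.
have /(congr1 (fun y => dotp y H)) := E.
rewrite dotpNl !dotpZl mulVf ?gt_eqF ?dotp_gt0//.
rewrite dotp_normal_part; last exact: mean_curvature_tangent.
by move=> E1; rewrite dotpC -[LHS](mulKf a0) -E1 mulrN1.
Qed.

End Charts.

(** * Orthogonal frames p, w, J p, J w of C^2 *)

Section OrthogonalFrame.
Context {R : realType}.
Variables (p w : 'rV[R]_(2 + 2)).
Hypotheses (p0 : p != 0) (w0 : w != 0).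
Hypotheses (pw : dotp p w = 0) (pJw : dotp p (cplxJ w) = 0).

(** The hypotheses say that p and w span a Lagrangian plane, so [lagrangian_frame] applies, and both
    of its projections of z vanish. *)
Lemma orthogonal_frame0 (z : 'rV[R]_(2 + 2)) : dotp z p = 0 -> dotp z w = 0 ->
  dotp z (cplxJ p) = 0 -> dotp z (cplxJ w) = 0 -> z = 0.
Proof.
move=> zp zw zJp zJw; pose Q : 'M[R]_(2, 2 + 2) := \matrix_i (if i == 0 then p else w).
have mulQ (y : 'rV[R]_(2 + 2)) : y *m Q^T = row2 (dotp y p) (dotp y w).
  by apply/rowP => j; rewrite !mxE; case: ifP => j0; rewrite dotpE;
    apply: eq_bigr => k _; rewrite !mxE j0.
have QQ : Q *m Q^T \in unitmx.
  apply: gram_unitmx => x /(congr1 (mulmx^~ Q^T)); rewrite mul0mx mulQ => E.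
  have xQ : x *m Q = x 0 0 *: p + x 0 1 *: w.
    rewrite mulmx_sum_row !big_ord_recl big_ord0 addr0 !rowK /=.
    by congr (_ + x _ _ *: _); apply/val_inj.
  have E0 := congr1 (fun r : 'rV[R]_2 => r 0 0) E.
  have E1 := congr1 (fun r : 'rV[R]_2 => r 0 1) E.
  rewrite !mxE /= xQ dotpDl !dotpZl (dotpC w) pw mulr0 addr0 in E0.
  rewrite !mxE /= xQ dotpDl !dotpZl pw mulr0 add0r in E1.
  rewrite (row2K x); move/eqP: E0; move/eqP: E1.
  have pp : dotp p p == 0 = false by rewrite gt_eqF// dotp_gt0.
  have ww : dotp w w == 0 = false by rewrite gt_eqF// dotp_gt0.
  rewrite !mulf_eq0 pp ww !orbF => /eqP-> /eqP->.
  by apply/rowP => j; rewrite !mxE if_same.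
have lagQ : Q *m cplxJmx *m Q^T = 0.
  apply/row_matrixP => i; rewrite !row_mul rowK row0 -cplxJE mulQ.
  apply/rowP => j; rewrite !mxE.
  by case: ifP => _; case: ifP => _; rewrite ?dotp_cplxJ0// dotp_cplxJl ?(dotpC w)
    ?dotp_cplxJl ?pJw ?opprK ?oppr0// -dotp_cplxJr.
have Z0 : row2 0 0 = 0 :> 'rV[R]_2 by apply/rowP => j; rewrite !mxE if_same.
rewrite (lagrangian_frame z QQ lagQ) !mulQ zp zw !dotp_cplxJl zJp zJw oppr0 Z0.
by rewrite !mul0mx cplxJ0 subrr.
Qed.

Lemma orthogonal_frame (z : 'rV[R]_(2 + 2)) :
  z = (dotp z p / dotp p p) *: p + (dotp z w / dotp w w) *: w +
      (dotp z (cplxJ p) / dotp p p) *: cplxJ p +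
      (dotp z (cplxJ w) / dotp w w) *: cplxJ w.
Proof.
have pp : dotp p p != 0 by rewrite gt_eqF// dotp_gt0.
have ww : dotp w w != 0 by rewrite gt_eqF// dotp_gt0.
have wp : dotp w p = 0 by rewrite dotpC.
have Jpw : dotp (cplxJ p) w = 0 by rewrite dotp_cplxJl pJw oppr0.
have wJp : dotp w (cplxJ p) = 0 by rewrite dotpC.
have Jwp : dotp (cplxJ w) p = 0 by rewrite dotpC.
have pJp : dotp p (cplxJ p) = 0 by rewrite dotpC dotp_cplxJ0.
have wJw : dotp w (cplxJ w) = 0 by rewrite dotpC dotp_cplxJ0.
apply/eqP; rewrite -subr_eq0; apply/eqP/orthogonal_frame0;
rewrite dotpBl !dotpDl !dotpZl ?dotp_cplxJ ?dotp_cplxJ0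
  ?pw ?wp ?pJw ?Jpw ?wJp ?Jwp ?pJp ?wJw ?dotp_cplxJ0;
by field; rewrite ?pp ?ww.
Qed.

End OrthogonalFrame.

(* Here c_ijk = <sigma(d_i, d_j), J d_k> and (k_ij) is the inverse of the metric
   (g_ij); (x0, x1) and (- p1, p0) are the coordinates of the tangent vector J f
   and of the tangent vector w orthogonal to it. *)
Section CubicForm.
Context {R : realType}.
Variables (g00 g01 g11 k00 k01 k11 x0 x1 c000 c001 c011 c111 : R).
Let p0 := x0 * g00 + x1 * g01.
Let p1 := x0 * g01 + x1 * g11.
Hypotheses (e1 : k00 * g00 + k01 * g01 = 1) (e2 : k00 * g01 + k01 * g11 = 0)
  (e3 : k01 * g00 + k11 * g01 = 0) (e4 : k01 * g01 + k11 * g11 = 1).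
Hypotheses (f1 : x0 * c000 + x1 * c001 = g00) (f2 : x0 * c001 + x1 * c011 = g01)
  (f3 : x0 * c011 + x1 * c111 = g11).
Hypothesis tr0 : k00 * (p0 * c001 - p1 * c000) + k01 * (p0 * c011 - p1 * c001)
  + (k01 * (p0 * c011 - p1 * c001) + k11 * (p0 * c111 - p1 * c011)) = 0.

(** In these names x stands for J f, d for w, and 0, 1 for the coordinate directions. This one is
    C(J f, J f, w) = <J f, w> = 0. *)
Lemma cubic_xxd : x0 ^+ 2 * (p0 * c001 - p1 * c000)
  + 2 * x0 * x1 * (p0 * c011 - p1 * c001) + x1 ^+ 2 * (p0 * c111 - p1 * c011) = 0.
Proof.
transitivity (p0 * (x0 * (x0 * c001 + x1 * c011) + x1 * (x0 * c011 + x1 * c111))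
  - p1 * (x0 * (x0 * c000 + x1 * c001) + x1 * (x0 * c001 + x1 * c011))); first by ring.
by rewrite f1 f2 f3 /p0 /p1; ring.
Qed.

(** In the orthogonal frame J f, w the trace of C(., ., w) is C(J f, J f, w) / |J f|^2 + C(w, w, w)
    / |w|^2, where |w|^2 = D |J f|^2 and D is the determinant of the metric. *)
Lemma cubic_ddd : p1 ^+ 2 * (p0 * c001 - p1 * c000)
  - 2 * p0 * p1 * (p0 * c011 - p1 * c001) + p0 ^+ 2 * (p0 * c111 - p1 * c011) = 0.
Proof.
set T0 := p0 * c001 - p1 * c000; set T1 := p0 * c011 - p1 * c001.
set T2 := p0 * c111 - p1 * c011.
pose D := g00 * g11 - g01 ^+ 2.
have d0 : D * k00 = g11.
  transitivity (g11 * (k00 * g00 + k01 * g01) - g01 * (k00 * g01 + k01 * g11)).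
    by rewrite /D; ring.
  by rewrite e1 e2; ring.
have d1 : D * k01 = - g01.
  transitivity (g11 * (k01 * g00 + k11 * g01) - g01 * (k01 * g01 + k11 * g11)).
    by rewrite /D; ring.
  by rewrite e3 e4; ring.
have d2 : D * k11 = g00.
  transitivity (g00 * (k01 * g01 + k11 * g11) - g01 * (k01 * g00 + k11 * g01)).
    by rewrite /D; ring.
  by rewrite e3 e4; ring.
have T : g11 * T0 - 2 * g01 * T1 + g00 * T2 = 0.
  rewrite -d0 -d2 -[X in 2 * X * _]opprK -d1.
  transitivity (D * (k00 * T0 + k01 * T1 + (k01 * T1 + k11 * T2))); first by ring.
  by rewrite tr0 mulr0.
have X := cubic_xxd; rewrite -/T0 -/T1 -/T2 in X.
transitivity ((x0 * p0 + x1 * p1) * (g11 * T0 - 2 * g01 * T1 + g00 * T2) -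
  D * (x0 ^+ 2 * T0 + 2 * x0 * x1 * T1 + x1 ^+ 2 * T2)).
  by rewrite /D /p0 /p1; ring.
by rewrite T X; ring.
Qed.

(** C(J f, w, w) = |w|^2, since C(J f, ., .) is the metric. *)
Lemma cubic_xdd : - (x0 * p1) * (p0 * c001 - p1 * c000)
  + (x0 * p0 - x1 * p1) * (p0 * c011 - p1 * c001) + x1 * p0 * (p0 * c111 - p1 * c011)
  = p1 ^+ 2 * g00 - 2 * p0 * p1 * g01 + p0 ^+ 2 * g11.
Proof.
transitivity (p1 ^+ 2 * (x0 * c000 + x1 * c001)
  - 2 * p0 * p1 * (x0 * c001 + x1 * c011) + p0 ^+ 2 * (x0 * c011 + x1 * c111)).
  by ring.
by rewrite f1 f2 f3.
Qed.

(** Decompose (x0 p0 + x1 p1) d_0 = p0 J f - x1 w: the w part contributes a multiple of C(w, w, w) =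
    0, hence the multiplier [- x1]. For d_1 the decomposition is p1 J f + x0 w. *)
Lemma cubic_0dd : (x0 * p0 + x1 * p1) *
  (p0 * (p0 * c011 - p1 * c001) - p1 * (p0 * c001 - p1 * c000)) =
  p0 * (p1 ^+ 2 * g00 - 2 * p0 * p1 * g01 + p0 ^+ 2 * g11).
Proof.
rewrite -cubic_xdd; apply/eqP; rewrite -subr_eq0 -(mulr0 (- x1)) -cubic_ddd.
by apply/eqP; ring.
Qed.

Lemma cubic_1dd : (x0 * p0 + x1 * p1) *
  (p0 * (p0 * c111 - p1 * c011) - p1 * (p0 * c011 - p1 * c001)) =
  p1 * (p1 ^+ 2 * g00 - 2 * p0 * p1 * g01 + p0 ^+ 2 * g11).
Proof.
rewrite -cubic_xdd; apply/eqP; rewrite -subr_eq0 -(mulr0 x0) -cubic_ddd.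
by apply/eqP; ring.
Qed.

(** C(v, v, w) for v = s J f + t w: the pure terms vanish by [cubic_xxd] and [cubic_ddd]. *)
Lemma cubic_form s t :
  let v0 := s * x0 + t * - p1 in let v1 := s * x1 + t * p0 in
  v0 * v0 * (p0 * c001 - p1 * c000) + v0 * v1 * (p0 * c011 - p1 * c001)
  + (v1 * v0 * (p0 * c011 - p1 * c001) + v1 * v1 * (p0 * c111 - p1 * c011)) =
  2 * s * t * (p1 ^+ 2 * g00 - 2 * p0 * p1 * g01 + p0 ^+ 2 * g11).
Proof.
rewrite /= -cubic_xdd; apply/eqP; rewrite -subr_eq0; apply/eqP.
transitivity (s ^+ 2 * (x0 ^+ 2 * (p0 * c001 - p1 * c000)
  + 2 * x0 * x1 * (p0 * c011 - p1 * c001) + x1 ^+ 2 * (p0 * c111 - p1 * c011))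
  + t ^+ 2 * (p1 ^+ 2 * (p0 * c001 - p1 * c000)
  - 2 * p0 * p1 * (p0 * c011 - p1 * c001) + p0 ^+ 2 * (p0 * c111 - p1 * c011))).
  by ring.
by rewrite cubic_xxd cubic_ddd !mulr0 addr0.
Qed.

End CubicForm.

(** * Lagrangian surfaces minimal in a sphere *)

HB.lock Definition chart_derivative (R : realType) n m
    (f : 'rV[R]_n -> 'rV[R]_m) (u v : 'rV[R]_n) : 'rV[R]_m :=
  v *m tangent_mx f u.

HB.lock Definition partial1_derivative (R : realType) n m
    (f : 'rV[R]_n -> 'rV[R]_m) (u v : 'rV[R]_n) (j : 'I_n) : 'rV[R]_m :=
  \sum_i v 0 i *: partial2 f i j u.

(** Components of the contact form of the sphere pulled back by f; when J f is tangent, they are its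
    covariant coordinates. *)
HB.lock Definition hopf_product (R : realType) n k
    (f : 'rV[R]_n -> 'rV[R]_(k + k)) (i : 'I_n) (u : 'rV[R]_n) : R :=
  dotp (partial1 f i u) (cplxJ (f u)).

(* Tangent and orthogonal to J f, hence horizontal for the Hopf fibration. *)
HB.lock Definition horizontal (R : realType) k (f : 'rV[R]_2 -> 'rV[R]_(k + k))
    (u : 'rV[R]_2) : 'rV[R]_(k + k) :=
  hopf_product f 0 u *: partial1 f 1 u - hopf_product f 1 u *: partial1 f 0 u.

Section LagrangianSphere.
Context {R : realType}.
Variables (U : set 'rV[R]_2) (f : 'rV[R]_2 -> 'rV[R]_(2 + 2)) (r2 : R).
Hypotheses (oU : open U) (smf : smooth_on U f).
Hypothesis imm : forall u, U u -> injective ('d f u).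
Hypothesis lag : forall u, U u -> forall X Y, kaehler_form ('d f u X) ('d f u Y) = 0.
Hypotheses (r2_gt0 : 0 < r2) (norm_f : forall u, U u -> dotp (f u) (f u) = r2).
Hypothesis minimal : forall u, U u -> forall y, dotp (f u) y = 0 ->
  dotp (mean_curvature f u) y = 0.
Implicit Types (u v : 'rV[R]_2) (y z : 'rV[R]_(2 + 2)) (i j k : 'I_2).

Local Notation d1 := (partial1 f).
Local Notation d2 := (partial2 f).
Local Notation J := cplxJ.

Let sum2 (V : zmodType) (g : 'I_2 -> V) : \sum_i g i = g 0 + g 1.
Proof.
by rewrite !big_ord_recl big_ord0 addr0; congr (_ + g _); apply/val_inj.
Qed.

Lemma is_derive_const u v (g : 'rV[R]_2 -> R) (c dg : R) : U u ->
  (forall x, U x -> g x = c) -> is_derive u v g dg -> dg = 0.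
Proof.
move=> Uu gc D; apply: is_derive_unique D _.
apply: (@near_eq_is_derive _ _ _ (fun=> c)).
by apply: filterS (near_chart oU Uu) => x Ux; rewrite gc.
Qed.

Local Notation dX := (chart_derivative f).
Local Notation dY := (partial1_derivative f).

Lemma dXE u v : dX u v = v 0 0 *: d1 0 u + v 0 1 *: d1 1 u.
Proof. by rewrite chart_derivative.unlock mul_tangent_mx sum2. Qed.

Lemma dX_delta u i : dX u (delta_mx 0 i) = d1 i u.
Proof. by rewrite chart_derivative.unlock -rowE row_tangent_mx. Qed.

Lemma dY_delta u i j : dY u (delta_mx 0 i) j = d2 i j u.
Proof.
rewrite partial1_derivative.unlock (bigD1 i)//= big1 ?addr0 => [|k /negPf ki];
  rewrite !mxE ?eqxx ?scale1r//.
by rewrite ki andbF scale0r.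
Qed.

Let derX u v : U u -> is_derive u v f (dX u v).
Proof. by rewrite chart_derivative.unlock; exact: is_derive_chart. Qed.

Let derY u v j : U u -> is_derive u v (d1 j) (dY u v j).
Proof. by rewrite partial1_derivative.unlock => Uu; exact: is_derive_partial1. Qed.

Lemma is_derive_cplxJ (g : 'rV[R]_2 -> 'rV[R]_(2 + 2)) u v dg :
  is_derive u v g dg -> is_derive u v (fun x => J (g x)) (J dg).
Proof.
move=> dg'; rewrite cplxJE; have := is_derive_mulmxr cplxJmx dg'.
by congr is_derive; apply/funext => x; rewrite cplxJE.
Qed.

Lemma dX_pos u v : U u -> dotp (dX u v) (f u) = 0.
Proof.
move=> Uu; have df := derX v Uu.
have := is_derive_const Uu norm_f (is_derive_dotp df df).
by rewrite (dotpC (f u)) -mulr2n => /eqP; rewrite mulrn_eq0 => /eqP.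
Qed.

Lemma d1_pos u i : U u -> dotp (d1 i u) (f u) = 0.
Proof. by move=> Uu; rewrite -dX_delta dX_pos. Qed.

Lemma d2_pos u i j : U u -> dotp (d2 i j u) (f u) = - dotp (d1 i u) (d1 j u).
Proof.
move=> Uu; apply/eqP; rewrite -addr_eq0; apply/eqP.
have := is_derive_dotp (derY (delta_mx 0 i) j Uu) (derX (delta_mx 0 i) Uu).
rewrite dX_delta dY_delta (dotpC (d1 j u)) => D.
by apply: is_derive_const Uu _ D => x /d1_pos.
Qed.

Lemma dX_lag u v w : U u -> dotp (dX u v) (J (dX u w)) = 0.
Proof.
move=> Uu; rewrite dotpC; have := lag Uu w v.
have df := chart_differentiable smf Uu.
by rewrite chart_derivative.unlock -!deriveE// !deriveEjacobian// !(jacobianE smf).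
Qed.

Lemma d1_lag u i j : U u -> dotp (d1 i u) (J (d1 j u)) = 0.
Proof. by move=> Uu; rewrite -!dX_delta dX_lag. Qed.

(** Differentiate <d_j f, J d_k f> = 0. As J d_k f is normal, this is the symmetry of C in its last
    two arguments; symmetry in the first two is [partial2C]. *)
Lemma d2_lag u i j k : U u ->
  dotp (d2 i j u) (J (d1 k u)) = dotp (d2 i k u) (J (d1 j u)).
Proof.
move=> Uu; have dk := is_derive_cplxJ (derY (delta_mx 0 i) k Uu).
have := is_derive_dotp (derY (delta_mx 0 i) j Uu) dk.
rewrite !dY_delta => D; have := is_derive_const Uu (fun x => @d1_lag x j k) D.
have -> : dotp (d1 j u) (J (d2 i k u)) = - dotp (d2 i k u) (J (d1 j u)).
  by rewrite dotp_cplxJr dotpC.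
by move=> /eqP; rewrite subr_eq0 => /eqP.
Qed.

Local Notation p := (hopf_product f).
Local Notation w := (horizontal f).

Definition hopf_product_derivative i u v : R :=
  dotp (dY u v i) (J (f u)) + dotp (d1 i u) (J (dX u v)).
Definition horizontal_derivative u v : 'rV[R]_(2 + 2) :=
  (hopf_product_derivative 0 u v *: d1 1 u + p 0 u *: dY u v 1)
  - (hopf_product_derivative 1 u v *: d1 0 u + p 1 u *: dY u v 0).

Lemma is_derive_horizontal u v : U u -> is_derive u v w (horizontal_derivative u v).
Proof.
move=> Uu; have dJf := is_derive_cplxJ (derX v Uu).
have dp i : is_derive u v (p i) (hopf_product_derivative i u v).
  by rewrite hopf_product.unlock; exact: is_derive_dotp (derY v i Uu) dJf.
rewrite horizontal.unlock; apply: is_deriveB; first exact: is_derive_fscale (dp 0) (derY v 1 Uu).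
exact: is_derive_fscale (dp 1) (derY v 0 Uu).
Qed.

Lemma horizontal_pos u : U u -> dotp (w u) (f u) = 0.
Proof. by move=> Uu; rewrite horizontal.unlock dotpBl !dotpZl !d1_pos// !mulr0 subrr. Qed.

Lemma horizontal_hopf u : dotp (w u) (J (f u)) = 0.
Proof. by rewrite horizontal.unlock dotpBl !dotpZl hopf_product.unlock mulrC subrr. Qed.

Lemma horizontal_lag u v : U u -> dotp (dX u v) (J (w u)) = 0.
Proof.
move=> Uu; rewrite horizontal.unlock cplxJB !cplxJZ dotpDr dotpNr !dotpZr -!dX_delta.
by rewrite !dX_lag// !mulr0 subrr.
Qed.

Lemma tangent_mx_gram u : U u -> tangent_mx f u *m (tangent_mx f u)^T \in unitmx.
Proof.
by move=> Uu; rewrite -(jacobianE smf Uu); exact: (metric_unitmx smf Uu (imm Uu)).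
Qed.

Lemma horizontal_norm u : dotp (w u) (w u) =
  p 1 u ^+ 2 * dotp (d1 0 u) (d1 0 u) - 2 * p 0 u * p 1 u * dotp (d1 0 u) (d1 1 u)
  + p 0 u ^+ 2 * dotp (d1 1 u) (d1 1 u).
Proof.
rewrite horizontal.unlock dotpBl !dotpZl !(dotpC _ (_ - _)) !dotpBl !dotpZl.
by rewrite (dotpC (d1 1 u) (d1 0 u)); ring.
Qed.

(** C(d_i, d_j, w): since J w is normal on U, sigma may be replaced there by the plain second
    derivatives. *)
Definition shape i j u : R := dotp (d2 i j u) (J (w u)).

Lemma shapeE i j u : shape i j u =
  p 0 u * dotp (d2 i j u) (J (d1 1 u)) - p 1 u * dotp (d2 i j u) (J (d1 0 u)).
Proof. by rewrite /shape horizontal.unlock cplxJB !cplxJZ dotpDr dotpNr !dotpZr. Qed.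

Lemma shape_trace u : U u ->
  \sum_i \sum_j invmx (metric f u) i j * shape i j u = 0.
Proof.
move=> Uu.
have JwP : J (w u) *m (jacobian f u)^T = 0.
  apply/rowP => i; rewrite [RHS]mxE; transitivity (dotp (d1 i u) (J (w u))).
    rewrite mxE dotpE; apply: eq_bigr => k _.
    by rewrite (jacobianE smf Uu) !mxE mulrC.
  by rewrite -dX_delta horizontal_lag.
have dsum (h : 'I_2 -> 'rV[R]_(2 + 2)) y : dotp (\sum_i h i) y = \sum_i dotp (h i) y.
  by rewrite !sum2 dotpDl.
transitivity (dotp (mean_curvature f u) (J (w u))); last first.
  by apply: minimal; rewrite // dotp_cplxJr dotpC horizontal_hopf oppr0.
rewrite /mean_curvature dsum; apply: eq_bigr => i _.
rewrite dsum; apply: eq_bigr => j _.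
by rewrite dotpZl second_ffE dotp_normal_part.
Qed.

(** Transfers the identities of [CubicForm] to the surface: r2 C(d_i, w, w) = <d_i f, J f> |w|^2,
    and C(v, v, w) = 2 s t |w|^2 for v = s J f + t w. *)
Lemma shape_values u : U u -> exists x0 x1 : R,
  [/\ J (f u) = x0 *: d1 0 u + x1 *: d1 1 u,
      forall i, r2 * (p 0 u * shape i 1 u - p 1 u * shape i 0 u) =
                p i u * dotp (w u) (w u) &
      forall s t : R, let v i := s * (if i == 0 then x0 else x1) +
                                 t * (if i == 0 then - p 1 u else p 0 u) in
        \sum_i \sum_j v i * v j * shape i j u = 2 * s * t * dotp (w u) (w u)].
Proof.
move=> Uu; pose P := tangent_mx f u; have gU := tangent_mx_gram Uu.
have lagP : P *m cplxJmx *m P^T = 0.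
  apply/row_matrixP => i; rewrite !row_mul row_tangent_mx -cplxJE row0.
  apply/rowP => j; rewrite [RHS]mxE; transitivity (dotp (J (d1 i u)) (d1 j u)).
    by rewrite mxE dotpE; apply: eq_bigr => k _; rewrite !mxE.
  by rewrite dotpC d1_lag.
have fP : f u *m P^T = 0.
  apply/rowP => j; rewrite [RHS]mxE; transitivity (dotp (f u) (d1 j u)).
    by rewrite mxE dotpE; apply: eq_bigr => k _; rewrite !mxE.
  by rewrite dotpC d1_pos.
pose x := J (f u) *m P^T *m invmx (P *m P^T).
have Jf : J (f u) = x 0 0 *: d1 0 u + x 0 1 *: d1 1 u.
  by rewrite (lagrangian_normal gU lagP fP) -/x mul_tangent_mx sum2.
pose g i j := dotp (d1 i u) (d1 j u).
pose C i j k := dotp (d2 i j u) (J (d1 k u)).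
have xC i j : x 0 0 * C i j 0 + x 0 1 * C i j 1 = g i j.
  rewrite /g /C -!dotpZr -dotpDr -!cplxJZ -cplxJD -Jf cplxJK dotpNr.
  by rewrite d2_pos// opprK.
have Cs i j k : C i j k = C i k j by exact: d2_lag.
have Cs' i j k : C i j k = C j i k by rewrite /C (partial2C oU smf).
have pE i : p i u = x 0 0 * g i 0 + x 0 1 * g i 1.
  by rewrite hopf_product.unlock Jf dotpDr !dotpZr.
have gC i j : g i j = g j i by exact: dotpC.
have r2E : r2 = x 0 0 * p 0 u + x 0 1 * p 1 u.
  by rewrite -(norm_f Uu) -dotp_cplxJ {1}Jf dotpDl !dotpZl hopf_product.unlock.
have metE i j : metric f u i j = g i j.
  rewrite /metric (jacobianE smf)// mxE /g dotpE.
  by apply: eq_bigr => k _; rewrite !mxE.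
pose K := invmx (metric f u).
have KC i j : K i j = K j i by rewrite /K -{1}[metric f u]tr_metric -trmx_inv mxE.
have Kg i j : K i 0 * g 0 j + K i 1 * g 1 j = (i == j)%:R.
  have := congr1 (fun A : 'M[R]_2 => A i j) (mulVmx (metric_unitmx smf Uu (imm Uu))).
  by rewrite !mxE sum2 !metE.
have := shape_trace Uu; rewrite !sum2 !shapeE -/K -!/(C _ _ _).
rewrite (Cs 0 1 0) (Cs' 1 0 1) (Cs' 1 0 0) (Cs 1 1 0) (Cs' 1 0 1) (Cs 0 1 0) (KC 1 0) => tr0.
have e1 : K 0 0 * g 0 0 + K 0 1 * g 0 1 = 1 by rewrite (gC 0 1) Kg.
have e2 : K 0 0 * g 0 1 + K 0 1 * g 1 1 = 0 by rewrite Kg.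
have e3 : K 0 1 * g 0 0 + K 1 1 * g 0 1 = 0 by rewrite (gC 0 1) (KC 0 1) Kg.
have e4 : K 0 1 * g 0 1 + K 1 1 * g 1 1 = 1 by rewrite (KC 0 1) Kg.
have f1 := xC 0 0; have f2 : x 0 0 * C 0 0 1 + x 0 1 * C 0 1 1 = g 0 1.
  by rewrite (Cs 0 0 1) xC.
have f3 : x 0 0 * C 0 1 1 + x 0 1 * C 1 1 1 = g 1 1 by rewrite (Cs' 0 1 1) (Cs 1 0 1) xC.
have p0E : p 0 u = x 0 0 * g 0 0 + x 0 1 * g 0 1 by rewrite pE.
have p1E : p 1 u = x 0 0 * g 0 1 + x 0 1 * g 1 1 by rewrite pE (gC 1 0).
have wE := horizontal_norm u; rewrite -!/(g _ _) in wE.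
have C1 : C 1 0 1 = C 0 1 1 by rewrite Cs'.
have C2 : C 1 1 0 = C 0 1 1 by rewrite Cs Cs'.
have C3 : C 1 0 0 = C 0 0 1 by rewrite Cs' Cs.
have C4 : C 0 1 0 = C 0 0 1 by rewrite Cs.
rewrite p0E p1E in tr0 wE r2E.
exists (x 0 0), (x 0 1); split=> // [i|s t /=].
  rewrite !shapeE -!/(C _ _ _) wE r2E.
  have [->|->] : i = 0 \/ i = 1.
    by case: i => [[|[|//]] ?]; [left|right]; apply/val_inj.
  - by rewrite p0E p1E C4 (cubic_0dd e1 e2 e3 e4 f1 f2 f3 tr0).
  - by rewrite p0E p1E C1 C2 C3 (cubic_1dd e1 e2 e3 e4 f1 f2 f3 tr0).
rewrite !sum2 /= !shapeE -!/(C _ _ _) wE p0E p1E C1 C2 C3 C4.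
exact: (cubic_form e1 e2 e3 e4 f1 f2 f3 tr0).
Qed.

Let hopf_norm u : U u -> dotp (J (f u)) (J (f u)) = r2.
Proof. by move=> Uu; rewrite dotp_cplxJ norm_f. Qed.

Lemma pos_neq0 u : U u -> f u != 0.
Proof. by move=> Uu; rewrite -dotp_gt0 norm_f. Qed.

Lemma horizontal_dX u : w u = dX u (row2 (- p 1 u) (p 0 u)).
Proof.
by rewrite dXE !mxE /= horizontal.unlock addrC scaleNr.
Qed.

(** If w vanished, injectivity of the differential would make both [p i u] zero; J f would be
    orthogonal to the tangent plane that contains it, against |J f|^2 = r2 > 0. *)
Lemma horizontal_neq0 u : U u -> w u != 0.
Proof.
move=> Uu; apply/negP => /eqP w0.
have [x0 [x1 [Jf _ _]]] := shape_values Uu.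
have df := chart_differentiable smf Uu.
have d0 : row2 (- p 1 u) (p 0 u) = 0.
  apply: (imm Uu); rewrite linear0 -deriveE// deriveEjacobian// (jacobianE smf)//.
  by move: w0; rewrite horizontal_dX chart_derivative.unlock.
have p0 : p 0 u = 0.
  by have := congr1 (fun r : 'rV[R]_2 => r 0 1) d0; rewrite !mxE.
have p1 : p 1 u = 0.
  have := congr1 (fun r : 'rV[R]_2 => r 0 0) d0; rewrite !mxE /= => /eqP.
  by rewrite oppr_eq0 => /eqP.
have := hopf_norm Uu; rewrite {1}Jf dotpDl !dotpZl.
move: p0 p1; rewrite hopf_product.unlock => -> ->; rewrite !mulr0 addr0 => r20.
by move: r2_gt0; rewrite -r20 ltxx.
Qed.

Let W_neq0 u : U u -> dotp (w u) (w u) != 0.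
Proof. by move=> Uu; rewrite gt_eqF// dotp_gt0 horizontal_neq0. Qed.

Let r2_neq0 : r2 != 0.
Proof. by rewrite gt_eqF. Qed.

Lemma pos_horizontal_cplxJ u : dotp (f u) (J (w u)) = 0.
Proof. by rewrite dotp_cplxJr dotpC horizontal_hopf oppr0. Qed.

Lemma sphere_frame u z : U u ->
  z = (dotp z (f u) / r2) *: f u + (dotp z (w u) / dotp (w u) (w u)) *: w u +
      (dotp z (J (f u)) / r2) *: J (f u) +
      (dotp z (J (w u)) / dotp (w u) (w u)) *: J (w u).
Proof.
move=> Uu; rewrite -(norm_f Uu); apply: orthogonal_frame.
- exact: pos_neq0.
- exact: horizontal_neq0.
- by rewrite dotpC horizontal_pos.
- exact: pos_horizontal_cplxJ.
Qed.

Lemma horizontal_derivative_hopf u v : U u -> dotp (horizontal_derivative u v) (J (f u)) = 0.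
Proof.
move=> Uu; have dJf := is_derive_cplxJ (derX v Uu).
have D := is_derive_dotp (is_derive_horizontal v Uu) dJf.
have := is_derive_const Uu (fun x _ => horizontal_hopf x) D.
by rewrite [X in _ + dotp X _]horizontal_dX dX_lag// addr0.
Qed.

(** J w is normal, so only the second derivatives in the derivative of w pair with it, and they
    produce C(v, w, w). *)
Lemma horizontal_derivative_cplxJ u v : U u ->
  r2 * dotp (horizontal_derivative u v) (J (w u)) =
  dotp (dX u v) (J (f u)) * dotp (w u) (w u).
Proof.
move=> Uu; have [x0 [x1 [_ sh _]]] := shape_values Uu.
have d1w i : dotp (d1 i u) (J (w u)) = 0 by rewrite -dX_delta horizontal_lag.
have dYw j : dotp (dY u v j) (J (w u)) = v 0 0 * shape 0 j u + v 0 1 * shape 1 j u.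
  by rewrite partial1_derivative.unlock sum2 dotpDl !dotpZl.
rewrite /horizontal_derivative dotpBl !dotpDl !dotpZl !d1w !dYw dXE dotpDl !dotpZl.
rewrite !mulr0 !add0r.
have p_i i : dotp (d1 i u) (J (f u)) = p i u by rewrite hopf_product.unlock.
rewrite !p_i mulrDl -!mulrA -!sh; ring.
Qed.

Lemma is_derive_moment u v : U u ->
  is_derive u v (fun x => moment (w x) (f x))
    (moment (horizontal_derivative u v) (f u) + moment (w u) (dX u v)).
Proof.
move=> Uu; apply/is_derive_mxP => i a; rewrite (ord1 i) !mxE.
have -> : (fun x => moment (w x) (f x) 0 a) =
    (fun x => dotp (w x) (f x *m su2mx (delta_mx 0 a))).
  by apply/funext => x; rewrite mxE.
have dS := is_derive_mulmxr (su2mx (delta_mx 0 a)) (derX v Uu).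
exact: is_derive_dotp (is_derive_horizontal v Uu) dS.
Qed.

(* The component of the derivative of w along J w and that of f along J f
   cancel by horizontal_derivative_cplxJ. *)
Lemma moment_derivative u v : U u -> exists l,
  moment (horizontal_derivative u v) (f u) + moment (w u) (dX u v) = l *: moment (w u) (f u).
Proof.
move=> Uu; set dw := horizontal_derivative u v; set X := dX u v.
(* The coefficient of [dw] along w. Its component along f contributes nothing, because f is
   orthogonal to [f u *m su2mx _]. *)
exists (dotp dw (w u) / dotp (w u) (w u)).
have E1 := sphere_frame dw Uu; rewrite horizontal_derivative_hopf// mul0r scale0r addr0 in E1.
have E2 := sphere_frame X Uu.
rewrite (dX_pos v Uu) (horizontal_lag v Uu) !mul0r !scale0r add0r addr0 in E2.
have E3 : dotp dw (J (w u)) / dotp (w u) (w u) = dotp X (J (f u)) / r2.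
  apply: (mulfI r2_neq0); rewrite mulrA horizontal_derivative_cplxJ// mulfK ?W_neq0//.
  by rewrite mulrCA mulfV// mulr1.
rewrite E3 in E1; apply/rowP => a; rewrite !mxE; set S := su2mx _.
rewrite {1}E2 {1}E1 !dotpDl !dotpZl mulmxDl dotpDr -!scalemxAl !dotpZr.
rewrite !dotp_su2mx0 -cplxJ_su2mx [dotp (w u) (J _)]dotp_cplxJr.
by ring.
Qed.

Lemma moment_neq0 u : U u -> moment (w u) (f u) != 0.
Proof.
move=> Uu; apply/negP => /eqP m0.
have := moment_su2mx (w u) (f u).
have -> : moment (w u) (f u) = 0 *: 0 by rewrite m0 scaler0.
rewrite su2mxZ scale0r horizontal_pos// scale0r subr0 norm_f// => /esym/eqP.
by rewrite scaler_eq0 (negPf r2_neq0) (negPf (horizontal_neq0 Uu)).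
Qed.

Lemma locally_constant (G : 'rV[R]_2 -> R) u : U u ->
  (forall x v, U x -> is_derive x v G 0) -> \forall x \near u, G x = G u.
Proof.
move=> Uu dG; have /nbhs_normP[e /= e0 eU] := near_chart oU Uu.
near=> x; have xe : `|u - x| < e.
  by near: x; exact: (nbhs_ball_norm u (PosNum e0)).
have inU t : 0 <= t <= 1 -> U (t *: (x - u) + u).
  case/andP => t0 t1; apply: eU; rewrite /ball_ /= opprD addrCA subrr addr0.
  by rewrite normrN normrZ ger0_norm// (le_lt_trans _ xe)// distrC ler_piMl.
have [t t01|t /andP[t0 t1] E] := @MVT_line R _ G u (x - u) 1 ltr01.
  by case: (dG _ (x - u) (inU t t01)).
have t01 : 0 <= t <= 1 by rewrite !ltW.
have [_ D] := dG _ (x - u) (inU t t01).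
by move: E; rewrite D mulr0 scale1r subrK => /eqP; rewrite subr_eq0 => /eqP.
Unshelve. all: by end_near. Qed.

Lemma dotp_moment_neq0 u : U u ->
  dotp (moment (w u) (f u)) (moment (w u) (f u)) != 0.
Proof. by move=> Uu; rewrite gt_eqF// dotp_gt0 moment_neq0. Qed.

(** These are the matrix coefficients of the orthogonal projection onto the line R m. They are
    invariant under rescaling of m, so they are stationary when the derivative of m is a multiple of
    m. *)
Lemma is_derive_moment_ratio u v mu nu : U u ->
  is_derive u v (fun x => let m := moment (w x) (f x) in
    dotp mu m * dotp nu m * (dotp m m)^-1) 0.
Proof.
move=> Uu; have dm := is_derive_moment v Uu.
have [l Dl] := moment_derivative v Uu; rewrite Dl in dm.
set m := fun x => moment (w x) (f x).
have dmu (a : 'rV[R]_3) : is_derive u v (fun x => dotp a (m x)) (l * dotp a (m u)).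
  have := is_derive_dotp (is_derive_cst a u v) dm.
  by rewrite dotp0l add0r dotpZr.
have dmm := is_derive_dotp dm dm.
have m0 : dotp (m u) (m u) != 0 by exact: dotp_moment_neq0.
have dV : is_derive u v (fun x => (dotp (m x) (m x))^-1)
    (- (dotp (m u) (m u)) ^- 2 *: (dotp (l *: m u) (m u) + dotp (m u) (l *: m u))).
  case: dmm => dm1 dm2; split; first exact: derivableV.
  by rewrite deriveV// dm2.
have := is_derive_fmul (is_derive_fmul (dmu mu) (dmu nu)) dV.
congr is_derive; rewrite dotpZl dotpZr /GRing.scale /=.
by field.
Qed.

Lemma locally_torus u : U u -> exists2 mu, mu != 0 &
  \forall x \near u, torus_form mu (f x) = 0.
Proof.
move=> Uu; set mu := moment (w u) (f u).
exists mu; first exact: moment_neq0.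
(* The projection of the fixed vector mu = m(u) onto R m(x) does not move with x; at u it is mu, so
   mu lies on every nearby line. *)
have C (a : 'I_3) := locally_constant Uu
  (fun x v => @is_derive_moment_ratio x v (delta_mx 0 a) mu).
have nC : \forall x \near u, forall a : 'I_3,
    dotp (delta_mx 0 a) (moment (w x) (f x)) * dotp mu (moment (w x) (f x)) *
    (dotp (moment (w x) (f x)) (moment (w x) (f x)))^-1 = mu 0 a.
  near=> x => a; move: a; near: x; apply: filter_forall => a.
  apply: filterS (C a) => x /= ->.
  by rewrite -mulrA mulfV ?dotp_moment_neq0// mulr1 /dotp -rowE !mxE.
apply: filterS (filterI nC (near_chart oU Uu)) => x [Hx Ux].
pose c := dotp mu (moment (w x) (f x)) / dotp (moment (w x) (f x)) (moment (w x) (f x)).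
have -> : mu = c *: moment (w x) (f x).
  by apply/rowP => a; rewrite -Hx mxE /c /dotp -rowE !mxE; ring.
rewrite torus_formZ /torus_form moment_su2mx horizontal_pos// scale0r subr0.
by rewrite dotpZr dotpC horizontal_hopf !mulr0.
Unshelve. all: by end_near. Qed.

(** The vector f mu is orthogonal to f always, to J f by the equation, and to J w by its derivative,
    so only the direction w of the frame is left. Thus mu is determined up to a factor, which lets
    local equations be glued. *)
Lemma torus_unique u mu : U u -> (\forall x \near u, torus_form mu (f x) = 0) ->
  exists2 t, f u *m su2mx mu = t *: w u & r2 *: mu = t *: moment (w u) (f u).
Proof.
move=> Uu tor; set S := su2mx mu.
have fSJ v : dotp (f u *m S) (J (dX u v)) = 0.
  have dJf := is_derive_cplxJ (derX v Uu).
  have D := is_derive_dotp dJf (is_derive_mulmxr S (derX v Uu)).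
  have E : dotp (J (dX u v)) (f u *m S) + dotp (J (f u)) (dX u v *m S) = 0.
    apply: is_derive_unique D _.
    by apply: (@near_eq_is_derive _ _ _ (fun=> 0)); apply: filterS tor => x <-.
  move: E; rewrite [dotp (J (f u)) _]dotpC dotp_su2mxl -cplxJ_su2mx.
  rewrite [X in _ - X]dotp_cplxJr opprK [X in _ + X]dotpC (dotpC (J _)).
  by rewrite -mulr2n => /eqP; rewrite mulrn_eq0 => /eqP.
have [x0 [x1 [Jf _ _]]] := shape_values Uu.
have E := sphere_frame (f u *m S) Uu.
have fSf : dotp (f u *m S) (f u) = 0 by rewrite dotpC dotp_su2mx0.
have fSJf : dotp (f u *m S) (J (f u)) = 0.
  by rewrite dotpC; exact: (nbhs_singleton tor).
have fSJw : dotp (f u *m S) (J (w u)) = 0 by rewrite horizontal_dX fSJ.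
rewrite fSf fSJf fSJw !mul0r !scale0r add0r !addr0 in E.
exists (dotp (f u *m S) (w u) / dotp (w u) (w u)) => //.
set t := _ / _ in E *.
apply/rowP => a; rewrite !mxE.
have := dotp_su2mx (f u) mu (delta_mx 0 a).
rewrite -/S E dotpZl norm_f// => ->.
by rewrite dotpC /dotp -rowE !mxE mulrC.
Qed.

(** On the normal plane spanned by f and J w the form is a nonzero multiple of a b, so its zeros
    there are two lines. *)
Lemma torus_form_frame u mu t (a b : R) : U u -> t != 0 ->
  f u *m su2mx mu = t *: w u ->
  torus_form mu (a *: f u + b *: J (w u)) = - 2 * (a * b) * (t * dotp (w u) (w u)).
Proof.
move=> Uu t0 fS; set S := su2mx mu in fS *.
have wS : t *: (w u *m S) = - dotp mu mu *: f u by rewrite scalemxAl -fS su2mxK.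
have wJS : dotp (w u) (J (w u *m S)) = 0.
  apply: (mulfI t0); rewrite mulr0 -dotpZr -cplxJZ wS cplxJZ dotpZr.
  by rewrite horizontal_hopf mulr0.
have fwS : dotp (f u) (w u *m S) = - (t * dotp (w u) (w u)).
  by rewrite -[LHS]opprK -dotp_su2mxl fS dotpZl.
rewrite /torus_form -/S mulmxDl -!scalemxAl fS cplxJD !cplxJZ cplxJK -cplxJ_su2mx.
rewrite dotpDl !dotpDr !dotpZl !dotpZr !dotpNl wJS dotp_cplxJ fwS.
by rewrite [dotp (J _) (w u)]dotpC horizontal_hopf; ring.
Qed.

Lemma height_gradient_hessian z : gradient_hessian_on U (fun x => dotp z (f x))
  (fun x => \row_j dotp z (d1 j x)) (fun x => \matrix_(i, j) dotp z (d2 i j x)).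
Proof.
move=> u Uu v; split.
  have := is_derive_dotp (is_derive_cst z u v) (derX v Uu); congr is_derive.
  by rewrite dotp0l add0r dXE [RHS]dotpE sum2 !mxE dotpDr !dotpZr.
apply/is_derive_mxP => i j; rewrite (ord1 i).
have -> : (fun x => (\row_j0 dotp z (d1 j0 x)) 0 j) = (fun x => dotp z (d1 j x)).
  by apply/funext => x; rewrite mxE.
have := is_derive_dotp (is_derive_cst z u v) (derY v j Uu); congr is_derive.
rewrite dotp0l add0r partial1_derivative.unlock mxE !sum2 !mxE dotpDr !dotpZr.
by [].
Qed.

Lemma torus_max u mu z : U u -> mu != 0 ->
  (\forall x \near u, torus_form mu (f x) = 0) ->
  dotp z z = r2 -> torus_form mu z = 0 ->
  (\forall x \near u, dotp z (f x) <= dotp z (f u)) -> z = f u.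
Proof.
move=> Uu mu0 tor zr zt zmax; have [t fS r2mu] := torus_unique Uu tor.
have t0 : t != 0.
  apply: contra_neq mu0 => t0; move/eqP: r2mu.
  by rewrite t0 scale0r scaler_eq0 (negPf r2_neq0) => /eqP.
have [G0 H0] := gradient_hessian_local_max oU (height_gradient_hessian z) Uu zmax.
have zd1 j : dotp z (d1 j u) = 0.
  by have := congr1 (fun r : 'rV[R]_2 => r 0 j) G0; rewrite !mxE.
have [x0 [x1 [Jf _ quad_shape]]] := shape_values Uu.
have zw : dotp z (w u) = 0.
  by rewrite horizontal.unlock dotpDr dotpNr !dotpZr !zd1 !mulr0 subrr.
have zJf : dotp z (J (f u)) = 0 by rewrite Jf dotpDr !dotpZr !zd1 !mulr0 addr0.
have zE := sphere_frame z Uu; rewrite zw zJf !mul0r !scale0r !addr0 in zE.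
set a := dotp z (f u) / r2 in zE; set b := _ / _ in zE.
clearbody a b.
have W0 := W_neq0 Uu; have W_gt0 : 0 < dotp (w u) (w u).
  by rewrite dotp_gt0 horizontal_neq0.
have zd2 i j : dotp z (d2 i j u) = - a * dotp (d1 i u) (d1 j u) + b * shape i j u.
  rewrite zE dotpDl !dotpZl dotpC d2_pos// mulrN mulNr; congr (_ + _ * _).
  by rewrite dotpC.
(* The Hessian of the height <z, f> in the direction s J f + r w. *)
have quad s r : - a * (s ^+ 2 * r2 + r ^+ 2 * dotp (w u) (w u))
    + b * (2 * s * r * dotp (w u) (w u)) <= 0.
  rewrite -quad_shape; pose v := row2 (s * x0 + r * - p 1 u) (s * x1 + r * p 0 u).
  have dv : dX u v = s *: J (f u) + r *: w u.
    rewrite dXE !mxE /= Jf horizontal.unlock scalerDr scalerBr !scalerA !scalerDl.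
    by rewrite mulrN scaleNr addrACA [- _ + _]addrC.
  have -> : s ^+ 2 * r2 + r ^+ 2 * dotp (w u) (w u) = dotp (dX u v) (dX u v).
    rewrite dv dotpDl !dotpDr !dotpZl !dotpZr hopf_norm// horizontal_hopf.
    by rewrite [dotp (J _) _]dotpC horizontal_hopf; ring.
  have := H0 v; congr (_ <= 0); rewrite dXE.
  rewrite dotpE !sum2 !mxE !sum2 !mxE /= !zd2 !dotpDl !dotpZl !dotpDr !dotpZr.
  by rewrite [dotp (d1 1 u) (d1 0 u)]dotpC; ring.
have ab : a * b = 0.
  move/eqP: zt; rewrite zE (torus_form_frame a b Uu t0 fS).
  rewrite !mulf_eq0 (negPf t0) (negPf W0) !orbF oppr_eq0 pnatr_eq0 /= => ab.
  by apply/eqP; rewrite mulf_eq0.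
have a0 : 0 <= a.
  have := quad 1 0; rewrite expr1n expr0n /= !(mulr0, mul0r, addr0) mul1r mulNr oppr_le0.
  by rewrite pmulr_lge0.
(* If a = 0, the directions J f + w and J f - w bound b |w|^2 by 0 from both sides. *)
have b0 : b = 0.
  move/eqP: ab; rewrite mulf_eq0 => /orP[/eqP az|/eqP//].
  have := quad 1 1; have := quad 1 (-1); rewrite az !(oppr0, mul0r, add0r) => q1 q2.
  have : b * dotp (w u) (w u) = 0 by lra.
  by move/eqP; rewrite mulf_eq0 (negPf W0) orbF => /eqP.
have : a ^+ 2 = 1.
  apply: (mulIf r2_neq0); rewrite mul1r -[RHS]zr zE b0 scale0r addr0.
  by rewrite dotpZl dotpZr norm_f// expr2 mulrA.
move/eqP; rewrite sqrf_eq1 => /orP[/eqP a1|/eqP a1].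
  by rewrite zE b0 a1 scale0r addr0 scale1r.
by move: a0; rewrite a1 lerNr oppr0 ler10.
Qed.

End LagrangianSphere.

(** * Unitary coordinates *)

Section Diagonalisation.
Context {R : realType}.
Implicit Types (mu : 'rV[R]_3) (z : 'rV[R]_(2 + 2)).

(* Acts on C^2 as the complex matrix with rows (n, c + ib) and (- c + ib, n). *)
Definition quaternion_mx (n b c : R) : 'M[R]_(2 + 2) :=
  block_mx (mx2 n c (- c) n) (mx2 0 b b 0) (mx2 0 (- b) (- b) 0) (mx2 n c (- c) n).

Lemma quaternion_mx_quad x1 x2 y1 y2 n b c :
  quad x1 x2 y1 y2 *m quaternion_mx n b c =
  quad (n * x1 - c * x2 - b * y2) (c * x1 + n * x2 - b * y1)
    (b * x2 + n * y1 - c * y2) (b * x1 + c * y1 + n * y2).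
Proof.
rewrite /quad mul_row_block !row2_mul !row2D.
by congr row_mx; apply: row2_eq; ring.
Qed.

Lemma tr_quaternion_mx n b c : (quaternion_mx n b c)^T = quaternion_mx n (- b) (- c).
Proof.
by rewrite /quaternion_mx tr_block_mx !tr_mx2 !opprK.
Qed.

Lemma quaternion_mx_unitary n b c : n ^+ 2 + b ^+ 2 + c ^+ 2 = 1 ->
  unitary (quaternion_mx n b c).
Proof.
move=> nbc; split; last first.
  move=> z; rewrite (quadP z) quaternion_mx_quad !cplxJ_quad quaternion_mx_quad.
  by apply: quad_eq; ring.
apply/row_matrixP => i; rewrite !rowE mulmx1 mulmxA tr_quaternion_mx.
rewrite (quadP (delta_mx _ _)) !quaternion_mx_quad.
rewrite -[RHS]scale1r -nbc quadZ.
by apply: quad_eq; ring.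
Qed.

Definition norm2_diff z : R :=
  (z 0 (lshift 2 0) ^+ 2 + z 0 (rshift 2 0) ^+ 2) -
  (z 0 (lshift 2 1) ^+ 2 + z 0 (rshift 2 1) ^+ 2).

Lemma norm2_diff_quad a b c d :
  norm2_diff (quad a b c d) = (a ^+ 2 + c ^+ 2) - (b ^+ 2 + d ^+ 2).
Proof. by rewrite /norm2_diff !row_mxEl !row_mxEr !mxE. Qed.

Lemma torus_form_diag_ge0 mu : mu != 0 -> 0 <= mu 0 0 ->
  exists2 U, unitary U & exists2 k, k != 0 &
    forall z, torus_form mu (z *m U) = k * norm2_diff z.
Proof.
move=> mu0 a0; pose N := Num.sqrt (dotp mu mu).
have N0 : 0 < N by rewrite sqrtr_gt0 dotp_gt0.
have NE : N ^+ 2 = mu 0 0 ^+ 2 + mu 0 1 ^+ 2 + mu 0 2%:R ^+ 2.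
  by rewrite sqr_sqrtr ?dotp_ge0// dotp3 !expr2.
(* The half-angle quaternion rotating mu onto the first axis: before normalisation, its real part is
   N + mu_0 and its imaginary part is, up to sign, the cross product of mu with that axis. The
   hypothesis mu_0 >= 0 keeps it away from 0. *)
pose n := N + mu 0 0; pose s2 := n ^+ 2 + mu 0 1 ^+ 2 + mu 0 2%:R ^+ 2.
have n0 : 0 < n by rewrite /n ltr_pwDl.
have s20 : 0 < s2 by rewrite /s2 -addrA ltr_pwDl ?exprn_gt0// addr_ge0 ?sqr_ge0.
pose s := Num.sqrt s2; have s0 : s != 0 by rewrite gt_eqF// sqrtr_gt0.
have sE : s ^+ 2 = s2 by rewrite sqr_sqrtr ?ltW.
exists (quaternion_mx (n / s) (mu 0 1 / s) (mu 0 2%:R / s)).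
  by apply: quaternion_mx_unitary; rewrite !expr_div_n -!mulrDl sE mulfV// gt_eqF.
exists N; first by rewrite gt_eqF.
move=> z; rewrite (quadP z) quaternion_mx_quad norm2_diff_quad.
rewrite /torus_form su2mx_quad cplxJ_quad dotp_quad.
have bc : mu 0 1 ^+ 2 + mu 0 2%:R ^+ 2 = N ^+ 2 - mu 0 0 ^+ 2 by rewrite NE; ring.
have s2N : s ^+ 2 = 2 * N * n by rewrite sE /s2 -addrA bc /n; ring.
move: (lsubmx z 0 0) (lsubmx z 0 1) (rsubmx z 0 0) (rsubmx z 0 1) => x1 x2 y1 y2.
have n0' : n != 0 by rewrite gt_eqF.
(* As mu_1^2 + mu_2^2 = N^2 - mu_0^2, both N and mu_0 are rational in n, mu_1 and mu_2, which leaves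
   an identity for [field]. *)
have NN : N = (n ^+ 2 + mu 0 1 ^+ 2 + mu 0 2%:R ^+ 2) / (2 * n).
  by rewrite -/s2 -sE s2N; field; rewrite n0'.
have aE : mu 0 0 = (n ^+ 2 - mu 0 1 ^+ 2 - mu 0 2%:R ^+ 2) / (2 * n).
  have -> : mu 0 0 = n - N by rewrite /n; ring.
  by rewrite NN; field; rewrite n0'.
apply: (mulIf (_ : s ^+ 2 != 0)); first by rewrite expf_neq0.
rewrite [in RHS]sE /s2 NN /= aE.
by field; rewrite n0' s0.
Qed.

Lemma torus_form_diag mu : mu != 0 ->
  exists2 U, unitary U & exists2 k, k != 0 &
    forall z, torus_form mu (z *m U) = k * norm2_diff z.
Proof.
move=> mu0; have [a0|a0] := leP 0 (mu 0 0); first exact: torus_form_diag_ge0.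
have [||U uU [k k0 kE]] := @torus_form_diag_ge0 (- 1 *: mu).
- by rewrite scaler_eq0 oppr_eq0 oner_eq0.
- by rewrite mxE mulN1r oppr_ge0 ltW.
exists U => //; exists (- k); rewrite ?oppr_eq0// => z.
by rewrite mulNr -kE torus_formZ mulN1r opprK.
Qed.

Lemma clifford_torusP z :
  clifford_torus R z <-> dotp z z = 2 /\ norm2_diff z = 0.
Proof.
have zz : dotp z z = (z 0 (lshift 2 0) ^+ 2 + z 0 (rshift 2 0) ^+ 2) +
    (z 0 (lshift 2 1) ^+ 2 + z 0 (rshift 2 1) ^+ 2).
  by rewrite {1 2}(quadP z) dotp_quad !mxE; ring.
rewrite zz /norm2_diff; split => [zC|[e1 e2] k].
  by rewrite !zC subrr.
have [->|->] : k = 0 \/ k = 1.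
  by case: k => [[|[|//]] ?]; [left|right]; apply/val_inj.
- lra.
- lra.
Qed.

Lemma unitary_torus mu (r2 : R) : mu != 0 -> 0 < r2 ->
  exists2 rho : R, 0 < rho & exists2 U : 'M[R]_(2 + 2), unitary U &
    [set z | dotp z z = r2 /\ torus_form mu z = 0] =
    [set rho *: (z *m U) | z in clifford_torus R].
Proof.
(* The Clifford torus lies in the sphere of squared radius 2. *)
move=> mu0 r20; pose rho := Num.sqrt (r2 / 2).
have rho0 : 0 < rho by rewrite sqrtr_gt0 divr_gt0.
have rhoE : rho ^+ 2 = r2 / 2 by rewrite sqr_sqrtr// divr_ge0 ?ltW.
have [U uU [k k0 kE]] := torus_form_diag mu0.
exists rho => //; exists U => //.
have torZ (x : R) z : torus_form mu (x *: z) = x ^+ 2 * torus_form mu z.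
  by rewrite /torus_form cplxJZ -scalemxAl dotpZl dotpZr expr2 mulrA.
have dotU z : dotp (z *m U) (z *m U) = dotp z z.
  by rewrite dotp_mulmxl -mulmxA uU.1 mulmx1.
apply/seteqP; split => [z [zr zt]|_ [z /clifford_torusP[z2 zd] <-]].
  have UU : U^T *m U = 1%:M by apply: mulmx1C; exact: uU.1.
  exists (rho^-1 *: (z *m U^T)); last first.
    by rewrite -scalemxAl scalerA mulfV ?gt_eqF// scale1r -mulmxA UU mulmx1.
  have zE : z = rho *: (rho^-1 *: (z *m U^T) *m U).
    by rewrite -scalemxAl scalerA mulfV ?gt_eqF// scale1r -mulmxA UU mulmx1.
  move: (rho^-1 *: _) zE => y zE; apply/clifford_torusP; split.
    move: zr; rewrite zE dotpZl dotpZr dotU mulrA -expr2 rhoE => yr.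
    apply: (mulfI (_ : r2 / 2 != 0)); first by rewrite mulf_neq0 ?gt_eqF.
    by rewrite yr divfK// pnatr_eq0.
  apply: (mulfI k0); apply: (mulfI (_ : rho ^+ 2 != 0)).
    by rewrite expf_neq0// gt_eqF.
  by rewrite !mulr0 -kE -torZ -zE.
split; last by rewrite torZ kE zd !mulr0.
by rewrite dotpZl dotpZr dotU z2 mulrA -expr2 rhoE divfK// pnatr_eq0.
Qed.

End Diagonalisation.

(** * Globalisation *)

Lemma connected_setT_ind (M : topologicalType) (S : set M) :
  connected [set: M] -> S !=set0 ->
  (forall p, S p -> \forall q \near p, S q) ->
  (forall p, ~ S p -> \forall q \near p, ~ S q) -> forall p, S p.
Proof.
move=> cM S0 oS oSC p.
suff -> : S = [set: M] by [].
apply: cM => //; exists S; rewrite ?setTI//; first by rewrite openE.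
by rewrite -openC openE.
Qed.

Section Atlas.
Context {R : realType} {n : nat} {M : topologicalType}.
Variable A : smooth_atlas R n M.

Lemma near_par i u (P : set M) : dom A i u ->
  (\forall q \near par A i u, P q) -> \forall x \near u, P (par A i x).
Proof. by move=> Ui; exact: (par_continuous Ui). Qed.

Lemma near_par_inv i u (P : set M) : dom A i u ->
  (\forall x \near u, P (par A i x)) -> \forall q \near par A i u, P q.
Proof.
move=> Ui nP.
have im : (par A i @` dom A i) (par A i u) by exists u.
have nI : \forall q \near par A i u, (par A i @` dom A i) q.
  by apply: open_nbhs_nbhs; split => //; exact: open_img.
have nC : \forall q \near par A i u, P (par A i (crd A i q)).
  have : crd A i q @[q --> par A i u] --> u by rewrite -{2}(parK Ui); exact: crd_continuous.
  by move/(_ _ nP).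
by apply: filterS (filterI nI nC) => q [[x Ux <-]]; rewrite parK.
Qed.

Lemma continuous_atlas {W : topologicalType} (phi : M -> W) :
  (forall i u, dom A i u -> {for u, continuous (phi \o par A i)}) ->
  continuous phi.
Proof.
move=> cphi p B; have [i [u Ui <-]] := atlas_cover A p => nB.
by apply: near_par_inv => //; exact: cphi.
Qed.

End Atlas.

Section Soliton.
Context {R : realType} {M : topologicalType}.
Variables (A : smooth_atlas R 2 M) (phi : M -> 'rV[R]_(2 + 2)).
Hypothesis mfdM : closed_connected_manifold M.
Hypothesis immphi : immersion A phi.
Hypothesis sol : homothetic_soliton A phi.

Let oU i : open (dom A i) := @open_dom _ _ _ A i.
Let smf i : smooth_on (dom A i) (phi \o par A i) := (immphi i).1.
Let imm i : forall u, dom A i u -> injective ('d (phi \o par A i) u) := (immphi i).2.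

Lemma immersion_continuous : continuous phi.
Proof. by apply: (continuous_atlas (A := A)) => i u; exact: continuous_chart. Qed.

Lemma soliton_norm_const :
  exists2 r2 : R, 0 < r2 & forall p, dotp (phi p) (phi p) = r2.
Proof.
have [_ cM conM M0] := mfdM; have [H0 [a a0 aE]] := sol.
have Hf i u : dom A i u -> dotp (mean_curvature (phi \o par A i) u)
    ((phi \o par A i) u) = - a^-1.
  by move=> Uu; apply: (soliton_dotp (@smf i) (@imm i) Uu) => //; [exact: H0|exact: aE].
pose F p : R := 2^-1 * dotp (phi p) (phi p).
have cF : continuous F.
  move=> p; suff : {for p, continuous F} by [].
  apply: (@continuousM _ _ (fun=> 2^-1)); first exact: cst_continuous.
  have cp : {for p, continuous phi} by exact: immersion_continuous.
  exact: (continuous_dotp cp cp).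
have [p1 _ min1] := compact_EVT_min M0 cM (continuous_subspaceT cF).
have [p2 _ max2] := compact_EVT_max M0 cM (continuous_subspaceT cF).
have ka : 0 <= 2%:R - a^-1.
  have [i [u Ui p1E]] := atlas_cover A p1.
  rewrite -(Hf i u Ui); apply: (half_norm2_local_min (@oU i) (@smf i) (@imm i) Ui).
  near=> x; suff : F (par A i u) <= F (par A i x) by [].
  by rewrite p1E; apply: min1; rewrite inE.
(* The set where F attains its maximum is open by the strong maximum principle and closed by
   continuity. *)
have Fc p : F p = F p2.
  apply: (@connected_setT_ind M [set p | F p = F p2]) => //; first by exists p2.
    move=> {}p; have [i [u Ui <-]] := atlas_cover A p => /= Fu.
    apply: near_par_inv => //.
    have maxu x : dom A i x -> F (par A i x) <= F (par A i u).
      by move=> Ux; rewrite Fu; apply: max2; rewrite inE.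
    have L0 x : dom A i x -> 0 <= 2%:R + dotp (mean_curvature (phi \o par A i) x)
        ((phi \o par A i) x) by move=> Ux; rewrite Hf.
    have := half_norm2_local_max (@oU i) (@smf i) (@imm i) L0 Ui maxu.
    by apply: filterS => x E; rewrite -Fu; exact: E.
  move=> {}p Fp; have : \forall q \near p, F q - F p2 != 0.
    have cG : {for p, continuous (fun q => F q - F p2)}.
      by apply: (@continuousB _ _ _ F (fun=> F p2)); [exact: cF|exact: cst_continuous].
    by apply: (cvgr_neq0 _ cG); rewrite subr_eq0; apply/eqP.
  by apply: filterS => q; rewrite subr_eq0 => /eqP.
exists (dotp (phi p2) (phi p2)) => [|p]; last first.
  by have /mulfI := Fc p; apply; rewrite invr_eq0 pnatr_eq0.
(* A zero of phi would give <H, phi> = 0 instead of -1/a. *)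
rewrite dotp_gt0; apply/negP => /eqP phi0.
have [i [u Ui p2E]] := atlas_cover A p2.
have := Hf i u Ui; rewrite /= p2E phi0 dotp0r => /esym/eqP.
by rewrite oppr_eq0 invr_eq0 (negPf a0).
Unshelve. all: by end_near. Qed.

Lemma soliton_minimal (r2 : R) : (forall p, dotp (phi p) (phi p) = r2) ->
  forall i u, dom A i u -> forall y, dotp (phi (par A i u)) y = 0 ->
  dotp (mean_curvature (phi \o par A i) u) y = 0.
Proof.
move=> norm_phi i u Ui y fy; have [H0 [a a0 aE]] := sol.
pose f := phi \o par A i.
have fP : f u *m (jacobian f u)^T = 0.
  apply/rowP => j; rewrite [RHS]mxE; transitivity (dotp (partial1 f j u) (f u)).
    rewrite dotpC dotpE mxE; apply: eq_bigr => k _.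
    by rewrite (jacobianE (@smf i) Ui) !mxE.
  by apply: (d1_pos (@oU i) (@smf i) _ _ Ui) => x Ux; exact: norm_phi.
have := congr1 (fun z => dotp z y) (aE i u Ui).
rewrite /= /normal_part -[phi (par A i u)]/(f u) fP !mul0mx subr0.
rewrite dotpNl !dotpZl [dotp (f u) y]fy mulr0 => /eqP.
rewrite oppr_eq0 mulf_eq0 invr_eq0 gt_eqF ?dotp_gt0 ?H0//= => /eqP.
exact.
Qed.

Hypothesis lag : lagrangian A phi.

Lemma soliton_torus : exists2 r2 : R, 0 < r2 & exists2 mu, mu != 0 &
  range phi = [set z | dotp z z = r2 /\ torus_form mu z = 0].
Proof.
have [r2 r20 norm_phi] := soliton_norm_const; exists r2 => //.
have [_ cM conM M0] := mfdM.
have nf i u : dom A i u -> dotp ((phi \o par A i) u) ((phi \o par A i) u) = r2.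
  by move=> _; exact: norm_phi.
have min i := soliton_minimal norm_phi i.
have local_torus (p : M) : exists2 mu, mu != 0 & \forall q \near p, torus_form mu (phi q) = 0.
  have [i [u Ui <-]] := atlas_cover A p.
  have [mu mu0 tor] := locally_torus (@oU i) (@smf i) (@imm i) (@lag i) r20 (@nf i) (@min i) Ui.
  by exists mu => //; apply: near_par_inv.
have unique_torus (p : M) (mu nu : 'rV[R]_3) : mu != 0 ->
    (\forall q \near p, torus_form mu (phi q) = 0) ->
    (\forall q \near p, torus_form nu (phi q) = 0) -> exists c, nu = c *: mu.
  have [i [u Ui <-]] := atlas_cover A p => mu0 /(near_par Ui) tmu /(near_par Ui) tnu.
  have tu := torus_unique (@oU i) (@smf i) (@imm i) (@lag i) r20 (@nf i) (@min i) Ui.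
  have [t _ tE] := tu _ tmu; have [s _ sE] := tu _ tnu.
  have r2n : r2 != 0 by rewrite gt_eqF.
  have t0 : t != 0.
    apply: contra_neq mu0 => t0; move/eqP: tE.
    by rewrite t0 scale0r scaler_eq0 (negPf r2n) => /eqP.
  exists (s / t); apply: (scalerI r2n).
  by rewrite sE scalerA mulrC -scalerA tE scalerA divfK.
have [p0 _] := M0; have [mu mu0 tor0] := local_torus p0.
have tor : forall p : M, \forall q \near p, torus_form mu (phi q) = 0.
  apply: connected_setT_ind => //; first by exists p0.
    by move=> p /nbhs_interior.
  (* Around p some nu works. If mu worked near a nearby q, uniqueness at q would make mu a multiple
     of nu, and mu would work near p. *)
  move=> p pS; have [nu nu0 tornu] := local_torus p.
  have := nbhs_interior tornu; apply: filterS => q tq; apply: contra_not pS => tmu.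
  have [c ->] := unique_torus q nu mu nu0 tq tmu.
  by apply: filterS tornu => x; rewrite torus_formZ => ->; rewrite mulr0.
exists mu => //; apply/seteqP; split => [_ [p _ <-]|z [zr zt]].
  by split; [exact: norm_phi|exact: nbhs_singleton (tor p)].
have ch : continuous (fun p => dotp z (phi p)).
  move=> p; have cp : {for p, continuous phi} by exact: immersion_continuous.
  have cz : {for p, continuous (fun=> z)} by exact: cst_continuous.
  exact: (continuous_dotp cz cp).
have [p _ maxp] := compact_EVT_max M0 cM (continuous_subspaceT ch).
exists p => //; have [i [u Ui pE]] := atlas_cover A p.
rewrite -pE; apply/esym.
apply: (torus_max (@oU i) (@smf i) (@imm i) (@lag i) r20 (@nf i) (@min i) Ui mu0 _ zr zt).
  exact: (near_par Ui (tor _)).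
by near=> x; rewrite /= pE; apply: maxp; rewrite inE.
Unshelve. all: by end_near. Qed.

End Soliton.

Theorem corollary3p6 (R : realType) (M : topologicalType)
    (A : smooth_atlas R 2 M) (phi : M -> 'rV[R]_(2 + 2)) :
  closed_connected_manifold M ->
  immersion A phi ->
  homothetic_soliton A phi ->
  lagrangian A phi ->
  exists2 rho : R, 0 < rho & exists2 U : 'M[R]_(2 + 2), unitary U &
    range phi = [set rho *: (z *m U) | z in clifford_torus R].
Proof.
move=> mfdM imm sol lag.
have [r2 r20 [mu mu0 ->]] := soliton_torus mfdM imm sol lag.
exact: unitary_torus.
Qed.
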